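(* The Poisson bracket of the Poisson algebra $\mathcal{P}_n$ is given by $$\begin{aligned} \{a_{ij},a_{kl}\}=\;&(\delta_{ik}-\delta_{ik'}+\delta_{jk}-\delta_{jk'}-\delta_{il}+\delta_{il'}-\delta_{jl}+\delta_{jl'})\,a_{ij}a_{kl}\\ &-2(\delta_{l<j}-\delta_{i<k})\,a_{kj}a_{il}-2\delta_{l<i}\,a_{ki}a_{lj}+2\delta_{j<k}\,a_{ik}a_{jl}\\ &+2\delta_{lj'}\sum_{m=1}^{j-1}\epsilon_m\epsilon_j\,a_{km'}a_{im}+2\delta_{li'}\sum_{m=i'+1}^{2n}\epsilon_i\epsilon_{m'}\,a_{km}a_{m'j}\\ &-2\delta_{jk'}\sum_{m=k'+1}^{2n}\epsilon_m\epsilon_{k'}\,a_{im}a_{m'l}-2\delta_{ik'}\sum_{m=i+1}^{2n}\epsilon_i\epsilon_m\,a_{mj}a_{m'l} \end{aligned}$$ for the generators $a_{ij},a_{kl}$ ($i>j$, $k>l$, indices in $\{1,\dots,2n\}$), where $a_{ii}=\epsilon_i$ and $a_{ij}=0$ for $i<j$.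
   Context: Fix $n\ge1$; $q$ is a formal variable. $\delta_{*}$ equals 1 if the condition $*$ holds and 0 otherwise ($\delta_{ij}$ is the Kronecker delta). For $1\le i\le 2n$ put $i'=2n+1-i$, $\epsilon_i=1$ if $i\le n$, $\epsilon_i=-1$ if $i>n$, and $(\rho_1,\dots,\rho_{2n})=(n,\dots,1,-1,\dots,-n)$. Let $e_{ij}$ be the elementary $2n\times 2n$ matrices, $D=\mathrm{diag}(q^{n},\dots,q,q^{-1},\dots,q^{-n})$, $J=\sum_k\epsilon_ke_{kk}$, and $$R=\sum_{i,j}q^{\delta_{ij}-\delta_{ij'}}e_{ii}\otimes e_{jj}+(q-q^{-1})\sum_{i<j}e_{ij}\otimes e_{ji}-(q-q^{-1})\sum_{i<j}q^{\rho_j-\rho_i}\epsilon_i\epsilon_j\,e_{ij}\otimes e_{i'j'} .$$ $u$ is the usual transposition $e_{ij}^u=e_{ji}$ and $t$ is the transposition $e_{ij}^t=\epsilon_i\epsilon_je_{j'i'}$ (acting on the matrix part only). For a matrix $X$ over an algebra, $X_1,X_2$ denote $X$ placed in the first, resp. second, copy of $\mathrm{End}\,\mathbb{C}^{2n}$. $U_q(\mathfrak{sp}_{2n})$ is the $\mathbb{C}(q)$-algebra generated by $t_{ij},\overline{t}_{ij}$ ($1\le i,j\le 2n$), with $T=(t_{ij})$, $\overline{T}=(\overline{t}_{ij})$, subject to $t_{ij}=\overline{t}_{ji}=0$ for $i<j$; $t_{ii}\overline{t}_{ii}=\overline{t}_{ii}t_{ii}=1$; $RT_1T_2=T_2T_1R$,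 $R\overline{T}_1\overline{T}_2=\overline{T}_2\overline{T}_1R$, $R\overline{T}_1T_2=T_2\overline{T}_1R$; and $TDT^tD^{-1}=\overline{T}D\overline{T}^tD^{-1}=I$, $DT^tD^{-1}T=D\overline{T}^tD^{-1}\overline{T}=I$. $U_q^{tw}(\mathfrak{gl}_n)$ is the subalgebra of $U_q(\mathfrak{sp}_{2n})$ generated by the entries $s_{ij}=\sum_{k=j}^{i}\epsilon_kt_{ik}\overline{t}_{jk}$ of $S=TJ\overline{T}^u$; one has $s_{ii}=\epsilon_i$ and $s_{ij}=0$ for $i<j$. Let $\mathbb{A}=\mathbb{C}[q,q^{-1}]$ and let $U'_{\mathbb{A}}$ be the $\mathbb{A}$-subalgebra of $U_q^{tw}(\mathfrak{gl}_n)$ generated by the $s_{ij}$, $i>j$. $\mathcal{P}_n=U'_{\mathbb{A}}\otimes_{\mathbb{A}}\mathbb{C}$, where $\mathbb{A}$ acts on $\mathbb{C}$ by evaluation at $q=1$; it is a commutative algebra, generated by the images $a_{ij}$ of $s_{ij}$, and it carries the Poisson bracket determined by $$\{a_{ij},a_{kl}\}=\frac{s_{ij}s_{kl}-s_{kl}s_{ij}}{1-q}\Big|_{q=1}$$ (the image in $\mathcal{P}_n$ of $(s_{ij}s_{kl}-s_{kl}s_{ij})/(1-q)\in U'_{\mathbb{A}}$). *)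

(* Defs.v *)
From HB Require Import structures.
From mathcomp Require Import all_boot all_order all_algebra.
From mathcomp Require Import generic_quotient fraction complex mxtens.
From mathcomp Require Import boolp classical_sets reals.
From mathcomp.multinomials Require Import monalg.

Set Implicit Arguments.
Unset Strict Implicit.
Unset Printing Implicit Defensive.

Import GRing.Theory.
Local Open Scope ring_scope.
Local Open Scope quotient_scope.

(* The free associative unital K-algebra on X, as the algebra of the free
   monoid on X. *)
Definition free_alg (K : comNzRingType) (X : choiceType) :=
  {malg K[{fmonom X}]}.

HB.instance Definition _ K X := GRing.Lalgebra.on (@free_alg K X).

Section FreeAlgebra.
Variables (K : comNzRingType) (X : choiceType).

Definition free_gen (x : X) : free_alg K X := mkmalgU (fmu x) 1.

Lemma free_scaleAr (a : K) (u v : free_alg K X) : a *: (u * v) = u * (a *: v).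
Proof.
suff aC (w : free_alg K X) : a%:MP * w = w * a%:MP :> {malg K[{fmonom X}]}.
  by rewrite -!mul_malgC mulrA aC -mulrA.
rewrite !malgM_def fgmulUg fgmulgU; apply: eq_bigr => k _.
by rewrite mul1m mulm1 mulrC.
Qed.

HB.instance Definition _ :=
  GRing.Lalgebra_isAlgebra.Build K (free_alg K X) free_scaleAr.

End FreeAlgebra.

(* The quotient of a K-algebra B by the two-sided ideal generated by the
   differences u - v for all pairs such that r u v. As this quotient may be
   zero, it is a pzRingType (not an nzRingType) with an lmodType K structure;
   quot_scaleAl and quot_scaleAr say that it is a K-algebra. *)
Section QuotientAlgebra.
Variables (K : comNzRingType) (B : algType K) (r : B -> B -> Prop).

Inductive rel_ideal : B -> Prop :=
| rel_ideal_gen u v : r u v -> rel_ideal (u - v)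
| rel_ideal0 : rel_ideal 0
| rel_idealD u v : rel_ideal u -> rel_ideal v -> rel_ideal (u + v)
| rel_idealMl w u : rel_ideal u -> rel_ideal (w * u)
| rel_idealMr u w : rel_ideal u -> rel_ideal (u * w).

Definition quot_equiv (u v : B) : bool := `[< rel_ideal (u - v) >].

Lemma rel_idealN u : rel_ideal u -> rel_ideal (- u).
Proof. by rewrite -mulN1r; apply: rel_idealMl. Qed.

Lemma rel_idealZ a u : rel_ideal u -> rel_ideal (a *: u).
Proof. by rewrite -mulr_algl; apply: rel_idealMl. Qed.

Fact quot_equiv_is_equiv : equiv_class_of quot_equiv.
Proof.
split=> [u|u v|v u w].
- by apply/asboolP; rewrite subrr; apply: rel_ideal0.
- by apply/asboolP/asboolP => /rel_idealN; rewrite opprB.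
- move=> /asboolP uv /asboolP vw; apply/asboolP.
  by rewrite -(subrKA v); apply: rel_idealD.
Qed.

Canonical quot_equivRel := EquivRelPack quot_equiv_is_equiv.
Canonical quot_encModRel := defaultEncModRel quot_equiv.

Definition quot_alg := {eq_quot quot_equiv}.

HB.instance Definition _ := Choice.on quot_alg.
HB.instance Definition _ := Quotient.on quot_alg.

Definition quot_pi (u : B) : quot_alg := \pi_quot_alg u.

Lemma quot_piE u v : quot_pi u = quot_pi v <-> rel_ideal (u - v).
Proof.
split=> [/eqmodP/asboolP //|uv].
by apply/eqmodP/asboolP.
Qed.

Definition quot_add (x y : quot_alg) := quot_pi (repr x + repr y).
Definition quot_opp (x : quot_alg) := quot_pi (- repr x).
Definition quot_mul (x y : quot_alg) := quot_pi (repr x * repr y).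
Definition quot_scale (a : K) (x : quot_alg) := quot_pi (a *: repr x).

Lemma quot_piK x : quot_pi (repr x) = x.
Proof. exact: reprK. Qed.

Lemma repr_quot_pi u : rel_ideal (repr (quot_pi u) - u).
Proof. by apply/quot_piE; rewrite quot_piK. Qed.

Lemma quot_addE u v : quot_add (quot_pi u) (quot_pi v) = quot_pi (u + v).
Proof.
by apply/quot_piE; rewrite opprD addrACA; apply: rel_idealD;
  apply: repr_quot_pi.
Qed.

Lemma quot_oppE u : quot_opp (quot_pi u) = quot_pi (- u).
Proof.
by apply/quot_piE; rewrite -opprD; apply/rel_idealN/repr_quot_pi.
Qed.

Lemma quot_mulE u v : quot_mul (quot_pi u) (quot_pi v) = quot_pi (u * v).
Proof.
apply/quot_piE; rewrite -(subrKA (repr (quot_pi u) * v)) -mulrBr -mulrBl.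
by apply: rel_idealD; [apply: rel_idealMl|apply: rel_idealMr];
  apply: repr_quot_pi.
Qed.

Lemma quot_scaleE a u : quot_scale a (quot_pi u) = quot_pi (a *: u).
Proof.
by apply/quot_piE; rewrite -scalerBr; apply/rel_idealZ/repr_quot_pi.
Qed.

Let quotW (P : quot_alg -> Prop) : (forall u, P (quot_pi u)) -> forall x, P x.
Proof. by move=> Ppi x; rewrite -(quot_piK x). Qed.

Fact quot_addA : associative quot_add.
Proof.
elim/quotW=> u; elim/quotW=> v; elim/quotW=> w.
by rewrite !quot_addE addrA.
Qed.

Fact quot_addC : commutative quot_add.
Proof. by elim/quotW=> u; elim/quotW=> v; rewrite !quot_addE addrC. Qed.

Fact quot_add0 : left_id (quot_pi 0) quot_add.
Proof. by elim/quotW=> u; rewrite !quot_addE add0r. Qed.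

Fact quot_addN : left_inverse (quot_pi 0) quot_opp quot_add.
Proof. by elim/quotW=> u; rewrite quot_oppE !quot_addE addNr. Qed.

HB.instance Definition _ := GRing.isZmodule.Build quot_alg
  quot_addA quot_addC quot_add0 quot_addN.

Fact quot_mulA : associative quot_mul.
Proof.
elim/quotW=> u; elim/quotW=> v; elim/quotW=> w.
by rewrite !quot_mulE mulrA.
Qed.

Fact quot_mul1 : left_id (quot_pi 1) quot_mul.
Proof. by elim/quotW=> u; rewrite !quot_mulE mul1r. Qed.

Fact quot_mulr1 : right_id (quot_pi 1) quot_mul.
Proof. by elim/quotW=> u; rewrite !quot_mulE mulr1. Qed.

Fact quot_mulDl : left_distributive quot_mul +%R.
Proof.
elim/quotW=> u; elim/quotW=> v; elim/quotW=> w.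
by rewrite /GRing.add /= !(quot_mulE, quot_addE) mulrDl.
Qed.

Fact quot_mulDr : right_distributive quot_mul +%R.
Proof.
elim/quotW=> u; elim/quotW=> v; elim/quotW=> w.
by rewrite /GRing.add /= !(quot_mulE, quot_addE) mulrDr.
Qed.

HB.instance Definition _ := GRing.Zmodule_isPzRing.Build quot_alg
  quot_mulA quot_mul1 quot_mulr1 quot_mulDl quot_mulDr.

Fact quot_scaleA a b x : quot_scale a (quot_scale b x) = quot_scale (a * b) x.
Proof. by elim/quotW: x => u; rewrite !quot_scaleE scalerA. Qed.

Fact quot_scale1 : left_id 1 quot_scale.
Proof. by elim/quotW=> u; rewrite !quot_scaleE scale1r. Qed.

Fact quot_scaleDr : right_distributive quot_scale +%R.
Proof.
move=> a; elim/quotW=> u; elim/quotW=> v.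
by rewrite /GRing.add /= !(quot_scaleE, quot_addE) scalerDr.
Qed.

Fact quot_scaleDl x : {morph quot_scale^~ x : a b / a + b}.
Proof.
move=> a b; elim/quotW: x => u.
by rewrite !quot_scaleE [RHS]quot_addE scalerDl.
Qed.

HB.instance Definition _ := GRing.Zmodule_isLmodule.Build K quot_alg
  quot_scaleA quot_scale1 quot_scaleDr quot_scaleDl.

Lemma quot_scaleAl (a : K) (x y : quot_alg) : a *: (x * y) = a *: x * y.
Proof.
elim/quotW: x => u; elim/quotW: y => v.
by rewrite /GRing.scale /GRing.mul /= !(quot_scaleE, quot_mulE) scalerAl.
Qed.

Lemma quot_scaleAr (a : K) (x y : quot_alg) : a *: (x * y) = x * (a *: y).
Proof.
elim/quotW: x => u; elim/quotW: y => v.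
by rewrite /GRing.scale /GRing.mul /= !(quot_scaleE, quot_mulE) scalerAr.
Qed.

Lemma quot_piD : {morph quot_pi : u v / u + v}.
Proof. by move=> u v; rewrite -quot_addE. Qed.

Lemma quot_piM : {morph quot_pi : u v / u * v}.
Proof. by move=> u v; rewrite -quot_mulE. Qed.

Lemma quot_piZ a : {morph quot_pi : u / a *: u}.
Proof. by move=> u; rewrite -quot_scaleE. Qed.

Lemma quot_pi0 : quot_pi 0 = 0. Proof. by []. Qed.
Lemma quot_pi1 : quot_pi 1 = 1. Proof. by []. Qed.

End QuotientAlgebra.

Local Notation "x %:F" := (@FracField.tofrac _ x).

(* The field C(q) over the complex numbers. *)
Notation ratC R := {fraction {poly complex R}}.

Section LaurentPolynomials.
Variable R : realType.
Local Notation C := (complex R).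

Definition qC : ratC R := ('X : {poly C})%:F.

(* The subring C[q, q^-1] of C(q). *)
Definition laurent_pred : {pred ratC R} :=
  fun x => `[< exists (p : {poly C}) (k : nat), x = p%:F / qC ^+ k >].

Lemma qC_neq0 : qC != 0.
Proof. by rewrite tofrac_eq0 polyX_eq0. Qed.

Let qXn_neq0 k : qC ^+ k != 0.
Proof. by rewrite expf_neq0 ?qC_neq0. Qed.

Fact laurent_subring_closed : subring_closed laurent_pred.
Proof.
split=> [|_ _ /asboolP[p [k ->]] /asboolP[p' [k' ->]]
         |_ _ /asboolP[p [k ->]] /asboolP[p' [k' ->]]]; apply/asboolP.
- by exists 1, 0; rewrite tofrac1 expr0 divr1.
- exists (p * 'X^k' - p' * 'X^k), (k + k')%N.
  rewrite tofracB !tofracM !tofracXn -/qC exprD.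
  by rewrite -[- (_ / _)]mulNr addf_div ?qXn_neq0 // mulNr.
- exists (p * p'), (k + k')%N.
  by rewrite tofracM exprD mulf_div.
Qed.

HB.instance Definition _ :=
  GRing.isSubringClosed.Build (ratC R) laurent_pred laurent_subring_closed.

Definition laurent := {x : ratC R | x \in laurent_pred}.
HB.instance Definition _ := SubType.on laurent.
HB.instance Definition _ := [Choice of laurent by <:].
HB.instance Definition _ := [SubChoice_isSubComNzRing of laurent by <:].

Lemma laurentP (a : laurent) :
  exists pk : {poly C} * nat, val a = pk.1%:F / qC ^+ pk.2.
Proof. by case: a => x /= /asboolP[p [k ->]]; exists (p, k). Qed.

(* Evaluation at q = 1; it does not depend on the chosen representation
   p / q^k, see eval1E. *)
Definition eval1 (a : laurent) : C := (projT1 (cid (laurentP a))).1.[1].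

Lemma eval1E (a : laurent) (p : {poly C}) k :
  val a = p%:F / qC ^+ k -> eval1 a = p.[1].
Proof.
rewrite /eval1; case: cid => -[p' k'] /= -> /eqP.
rewrite eqr_div ?qXn_neq0 // /qC -!tofracXn -!tofracM tofrac_eq => /eqP/(congr1 (horner^~ 1)).
by rewrite !hornerM !hornerXn !expr1n !mulr1.
Qed.

Fact eval1_is_zmod_morphism : zmod_morphism eval1.
Proof.
move=> a b; have [[p k] /= pE] := laurentP a; have [[r l] /= rE] := laurentP b.
rewrite (eval1E pE) (eval1E rE) (@eval1E _ (p * 'X^l - r * 'X^k) (k + l)).
  by rewrite hornerD hornerN !hornerM !hornerXn !expr1n !mulr1.
rewrite rmorphB /= pE rE tofracB !tofracM !tofracXn -/qC exprD.
by rewrite -[- (_ / _)]mulNr addf_div ?qXn_neq0 // mulNr.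
Qed.

Fact eval1_is_monoid_morphism : monoid_morphism eval1.
Proof.
split=> [|a b].
  by rewrite (@eval1E _ 1 0) ?hornerC // expr0 divr1 tofrac1.
have [[p k] /= pE] := laurentP a; have [[r l] /= rE] := laurentP b.
rewrite (eval1E pE) (eval1E rE) (@eval1E _ (p * r) (k + l)) ?hornerM //.
by rewrite rmorphM /= pE rE tofracM exprD mulf_div.
Qed.

HB.instance Definition _ :=
  GRing.isZmodMorphism.Build laurent C eval1 eval1_is_zmod_morphism.
HB.instance Definition _ :=
  GRing.isMonoidMorphism.Build laurent C eval1 eval1_is_monoid_morphism.

End LaurentPolynomials.

Arguments qC {R}.

(* Indices are 0-based: the ordinal i : 'I_(2 * n) stands for the index i + 1,
   so that i' is rev_ord i, and the condition i <= n becomes i < n. *)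
Section SymplecticData.
Variable n : nat.
Local Notation N := (2 * n)%N.

Definition eps (A : pzRingType) (i : 'I_N) : A := if (i < n)%N then 1 else -1.

Definition rho (i : 'I_N) : int :=
  if (i < n)%N then n%:Z - i%:Z else n%:Z - i%:Z - 1.

(* The transposition t : e_ij |-> eps_i eps_j e_(j'i'), on matrix units. *)
Definition sp_trmx (A : pzRingType) (X : 'M[A]_N) : 'M[A]_N :=
  \matrix_(i, j) (eps A (rev_ord j) * eps A (rev_ord i)
                  * X (rev_ord j) (rev_ord i)).

Variable R : realType.

Definition Dmx : 'M[ratC R]_N := \matrix_(i, j) (qC ^ rho i *+ (i == j)).

(* End (C^N) (x) End (C^N) is identified with the matrices of size N * N via
   the Kronecker product A *t B. *)
Definition Rmx : 'M[ratC R]_(N * N) :=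
  \sum_(i < N) \sum_(j < N) qC ^ ((i == j)%:Z - (i == rev_ord j)%:Z)
    *: (delta_mx i i *t delta_mx j j)
  + (qC - qC^-1) *:
    (\sum_(i < N) \sum_(j < N | (i < j)%N) delta_mx i j *t delta_mx j i)
  - (qC - qC^-1) *:
    (\sum_(i < N) \sum_(j < N | (i < j)%N)
      (qC ^ (rho j - rho i) * eps _ i * eps _ j)
        *: (delta_mx i j *t delta_mx (rev_ord i) (rev_ord j))).

(* The generators of U_q(sp_2n) = Uq: inl (i, j) is t_ij, inr (i, j) is tbar_ij. *)
Definition Uq_gens := ('I_N * 'I_N + 'I_N * 'I_N)%type.

Local Notation Free := (free_alg (ratC R) Uq_gens).
Local Notation "A %:U" := (map_mx (in_alg Free) A) (at level 2).

Definition freeT : 'M[Free]_N := \matrix_(i, j) free_gen _ (inl (i, j)).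
Definition freeTb : 'M[Free]_N := \matrix_(i, j) free_gen _ (inr (i, j)).

Local Notation T := freeT.
Local Notation Tb := freeTb.
Local Notation "X '_1'" := (X *t (1%:M : 'M_N)) (at level 2).
Local Notation "X '_2'" := ((1%:M : 'M_N) *t X) (at level 2).
Local Notation Rm := (Rmx%:U).
Local Notation D := (Dmx%:U).
Local Notation Dinv := ((invmx Dmx)%:U).

Inductive Uq_rel : Free -> Free -> Prop :=
| Uq_tri (i j : 'I_N) : (i < j)%N -> Uq_rel (T i j) 0
| Uq_trib (i j : 'I_N) : (i < j)%N -> Uq_rel (Tb j i) 0
| Uq_diag i : Uq_rel (T i i * Tb i i) 1
| Uq_diagb i : Uq_rel (Tb i i * T i i) 1
| Uq_RTT i j : Uq_rel ((Rm *m T _1 *m T _2) i j) ((T _2 *m T _1 *m Rm) i j)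
| Uq_RTbTb i j :
    Uq_rel ((Rm *m Tb _1 *m Tb _2) i j) ((Tb _2 *m Tb _1 *m Rm) i j)
| Uq_RTbT i j : Uq_rel ((Rm *m Tb _1 *m T _2) i j) ((T _2 *m Tb _1 *m Rm) i j)
| Uq_TTt i j :
    Uq_rel ((T *m D *m sp_trmx T *m Dinv) i j) ((1%:M : 'M[Free]_N) i j)
| Uq_TbTbt i j :
    Uq_rel ((Tb *m D *m sp_trmx Tb *m Dinv) i j) ((1%:M : 'M[Free]_N) i j)
| Uq_TtT i j :
    Uq_rel ((D *m sp_trmx T *m Dinv *m T) i j) ((1%:M : 'M[Free]_N) i j)
| Uq_TbtTb i j :
    Uq_rel ((D *m sp_trmx Tb *m Dinv *m Tb) i j) ((1%:M : 'M[Free]_N) i j).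

Definition Uq := quot_alg Uq_rel.
HB.instance Definition _ := GRing.PzRing.on Uq.
HB.instance Definition _ := GRing.Lmodule.on Uq.

Definition Tmx : 'M[Uq]_N := map_mx (@quot_pi _ _ Uq_rel) T.
Definition Tbmx : 'M[Uq]_N := map_mx (@quot_pi _ _ Uq_rel) Tb.
Definition Jmx : 'M[Uq]_N := \matrix_(i, j) (eps Uq i *+ (i == j)).

(* The matrix S = T J Tb^u; its entries generate U_q^tw(gl_n). *)
Definition Smx : 'M[Uq]_N := Tmx *m Jmx *m Tbmx^T.

(* U'_A is the C[q, q^-1]-subalgebra generated by the s_ij with i > j. It is
   taken inside U_q(sp_2n), which contains U_q^tw(gl_n). *)
Inductive UA_span : Uq -> Prop :=
| UA_gen (i j : 'I_N) : (j < i)%N -> UA_span (Smx i j)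
| UA_1 : UA_span 1
| UA_D u v : UA_span u -> UA_span v -> UA_span (u + v)
| UA_M u v : UA_span u -> UA_span v -> UA_span (u * v)
| UA_Z (a : laurent R) u : UA_span u -> UA_span (val a *: u).

Definition UA_pred : {pred Uq} := fun u => `[< UA_span u >].

Fact UA_subring_closed : subring_closed UA_pred.
Proof.
split=> [|u v /asboolP uU /asboolP vU|u v /asboolP uU /asboolP vU];
  apply/asboolP; first exact: UA_1; last exact: UA_M.
apply: UA_D => //; rewrite -scaleN1r.
by have := UA_Z (-1) vU; rewrite rmorphN1.
Qed.

HB.instance Definition _ :=
  GRing.isSubringClosed.Build Uq UA_pred UA_subring_closed.

Definition UA := {u : Uq | u \in UA_pred}.
HB.instance Definition _ := SubType.on UA.
HB.instance Definition _ := [Choice of UA by <:].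
HB.instance Definition _ :=
  GRing.SubChoice_isSubPzRing.Build Uq UA_pred UA UA_subring_closed.

Fact UA_scale_subproof (a : laurent R) (u : UA) : val a *: val u \in UA_pred.
Proof. by apply/asboolP/UA_Z/asboolP/(valP u). Qed.

Definition UA_scale (a : laurent R) (u : UA) : UA :=
  Sub (val a *: val u) (UA_scale_subproof a u).

Fact UA_scaleA a b u : UA_scale a (UA_scale b u) = UA_scale (a * b) u.
Proof. by apply: val_inj; rewrite /= scalerA. Qed.

Fact UA_scale1 : left_id 1 UA_scale.
Proof. by move=> u; apply: val_inj; rewrite /= scale1r. Qed.

Fact UA_scaleDr : right_distributive UA_scale +%R.
Proof.
by move=> a u v; apply: val_inj; rewrite /= scalerDr.
Qed.

Fact UA_scaleDl u : {morph UA_scale^~ u : a b / a + b}.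
Proof.
by move=> a b; apply: val_inj; rewrite /= scalerDl.
Qed.

HB.instance Definition _ := GRing.Zmodule_isLmodule.Build (laurent R) UA
  UA_scaleA UA_scale1 UA_scaleDr UA_scaleDl.

(* The tensor product P_n of the C[q, q^-1]-algebras U'_A and C, presented as
   the C-algebra on the symbols u (x) c. *)
Local Notation FreeP := (free_alg (complex R) (UA * complex R)%type).
Local Notation "u '(x)' c" :=
  (free_gen (complex R) (X := (UA * complex R)%type) (u, c)) (at level 38).

Inductive tensor_rel : FreeP -> FreeP -> Prop :=
| tensor_Dl (u v : UA) (c : complex R) :
    tensor_rel ((u + v) (x) c) (u (x) c + v (x) c)
| tensor_Dr (u : UA) (c d : complex R) :
    tensor_rel (u (x) (c + d)) (u (x) c + u (x) d)
| tensor_balanced (a : laurent R) (u : UA) (c : complex R) :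
    tensor_rel ((a *: u) (x) c) (u (x) (eval1 a * c))
| tensor_scale (d : complex R) (u : UA) (c : complex R) :
    tensor_rel (d *: (u (x) c)) (u (x) (d * c))
| tensor_M (u v : UA) (c d : complex R) :
    tensor_rel ((u (x) c) * (v (x) d)) ((u * v) (x) (c * d))
| tensor_1 : tensor_rel (1 (x) 1) 1.

Definition Pn := quot_alg tensor_rel.
HB.instance Definition _ := GRing.PzRing.on Pn.
HB.instance Definition _ := GRing.Lmodule.on Pn.

Definition to_Pn (u : UA) : Pn := quot_pi tensor_rel (u (x) 1).

(* The semiclassical bracket: the bracket of the classes of u and v is the class
   of (u v - v u) / (1 - q), provided that this quotient of U_q(sp_2n) lies in
   U'_A. Existence of such a class is not built in: xget returns 0 if there is
   none. *)
Definition Pn_bracket_spec (x y z : Pn) : Prop :=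
  exists u v w : UA, [/\ x = to_Pn u, y = to_Pn v, z = to_Pn w &
    val w = (1 - qC)^-1 *: (val u * val v - val v * val u)].

Definition Pn_bracket (x y : Pn) : Pn :=
  xget 0 [set z | Pn_bracket_spec x y z]%classic.

(* a_gen uses sUA i j only for j < i, where it is s_ij (val_sUA). *)
Definition sUA (i j : 'I_N) : UA := insubd 0 (Smx i j).

Lemma val_sUA (i j : 'I_N) : (j < i)%N -> val (sUA i j) = Smx i j.
Proof. by move=> ji; rewrite val_insubd ifT //; apply/asboolP/UA_gen. Qed.

Definition a_gen (i j : 'I_N) : Pn :=
  if (j < i)%N then to_Pn (sUA i j) else if i == j then eps Pn i else 0.

End SymplecticData.

(* Main.v *)
Require Import Defs.
From HB Require Import structures.
From mathcomp Require Import all_boot all_order all_algebra.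
From mathcomp Require Import fraction complex mxtens.
From mathcomp Require Import boolp classical_sets reals zify ring.
From mathcomp.multinomials Require Import monalg.

(* The matrix S = T J Tb^u satisfies the reflection equation
     R S_1 R^(u_1) S_2 = S_2 R^(u_1) S_1 R.
   It follows from the RTT relations, from R^u = R_21 and from the same equation
   for the constant matrix J.  Writing R = 1 - (1 - q) r, where r has entries in
   Z[q, q^-1], the reflection equation becomes
     S_1 S_2 - S_2 S_1 = (1 - q) (r S_1 R^(u_1) S_2 + S_1 r^(u_1) S_2
                                  - S_2 r^(u_1) S_1 R - S_2 S_1 r),
   which exhibits the quotient of the commutator by 1 - q as an element of U'_A
   and shows that P_n is commutative on the image of U'_A.  At q = 1 the matrix R
   becomes 1 and the right-hand side expands to the stated formula.  The bracket
   does not depend on the lifts to U'_A because the kernel of U'_A -> P_n is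
   (1 - q) U'_A and commutators vanish in P_n. *)

Set Implicit Arguments.
Unset Strict Implicit.
Unset Printing Implicit Defensive.

Import GRing.Theory.
Local Open Scope ring_scope.

Local Notation ti a c := (mxtens_index (a, c)).

(** * Matrices acting on a tensor square *)

Section TensorSquare.
Variables (A : pzRingType) (N : nat).
Local Notation "X '_1'" := (X *t (1%:M : 'M[A]_N)) (at level 2).
Local Notation "X '_2'" := ((1%:M : 'M[A]_N) *t X) (at level 2).
Implicit Types (M : 'M[A]_(N * N)) (X Y : 'M[A]_N).

Lemma tensmxP M M' :
  (forall a c b d, M (ti a c) (ti b d) = M' (ti a c) (ti b d)) -> M = M'.
Proof.
move=> eqM; apply/matrixP => x y.
by case: (mxtens_indexP x) => a c; case: (mxtens_indexP y).
Qed.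

Lemma sum_tens (F : 'I_(N * N) -> A) :
  \sum_x F x = \sum_a \sum_c F (ti a c).
Proof.
rewrite pair_bigA /=; apply: reindex.
by exists (@mxtens_unindex N N) => x _;
  rewrite ?mxtens_unindexK // -surjective_pairing mxtens_indexK.
Qed.

Lemma mulmx_tensE M M' x y :
  (M *m M') x y = \sum_a \sum_c M x (ti a c) * M' (ti a c) y.
Proof. by rewrite mxE sum_tens. Qed.

Lemma mul_in1mxE X M a c y :
  (X _1 *m M) (ti a c) y = \sum_p X a p * M (ti p c) y.
Proof.
rewrite mulmx_tensE; apply: eq_bigr => p _.
rewrite (bigD1 c) //= tensmxE mxE eqxx mulr1 big1 ?addr0 // => q qc.
by rewrite tensmxE mxE eq_sym (negPf qc) mulr0 mul0r.
Qed.

Lemma mul_in2mxE X M a c y :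
  (X _2 *m M) (ti a c) y = \sum_p X c p * M (ti a p) y.
Proof.
rewrite mulmx_tensE exchange_big; apply: eq_bigr => p _ /=.
rewrite (bigD1 a) //= tensmxE mxE eqxx mul1r big1 ?addr0 // => q qa.
by rewrite tensmxE mxE eq_sym (negPf qa) !mul0r.
Qed.

Lemma mulmx_in1E X M x b d :
  (M *m X _1) x (ti b d) = \sum_p M x (ti p d) * X p b.
Proof.
rewrite mulmx_tensE; apply: eq_bigr => p _.
rewrite (bigD1 d) //= tensmxE mxE eqxx mulr1 big1 ?addr0 // => q qc.
by rewrite tensmxE mxE (negPf qc) !mulr0.
Qed.

Lemma mulmx_in2E X M x b d :
  (M *m X _2) x (ti b d) = \sum_p M x (ti b p) * X p d.
Proof.
rewrite mulmx_tensE exchange_big; apply: eq_bigr => p _ /=.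
rewrite (bigD1 b) //= tensmxE mxE eqxx mul1r big1 ?addr0 // => q qa.
by rewrite tensmxE mxE (negPf qa) mul0r mulr0.
Qed.

Definition tensE := (mul_in1mxE, mul_in2mxE, mulmx_in1E, mulmx_in2E).

Lemma in1M X Y : (X *m Y) _1 = X _1 *m Y _1.
Proof.
apply: tensmxP => a c b d; rewrite tensE tensmxE !mxE mulr_suml.
by apply: eq_bigr => p _; rewrite tensmxE mxE mulrA.
Qed.

Lemma in2M X Y : (X *m Y) _2 = X _2 *m Y _2.
Proof.
apply: tensmxP => a c b d; rewrite tensE tensmxE !mxE mulr_sumr.
by apply: eq_bigr => p _; rewrite tensmxE mxE !mulrA -[_%:R * X _ _]commr_nat.
Qed.

(* Transposition in the first tensor factor. *)
Definition ptrmx M : 'M[A]_(N * N) :=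
  \matrix_(x, y) M (ti (mxtens_unindex y).1 (mxtens_unindex x).2)
                   (ti (mxtens_unindex x).1 (mxtens_unindex y).2).

Lemma ptrmxE M a c b d : ptrmx M (ti a c) (ti b d) = M (ti b c) (ti a d).
Proof. by rewrite mxE !mxtens_indexK. Qed.

Lemma mxDE M M' x y : (M + M') x y = M x y + M' x y.
Proof. by rewrite mxE. Qed.

Lemma mxNE M x y : (- M) x y = - M x y.
Proof. by rewrite mxE. Qed.

Lemma mxZE z M x y : (z *: M) x y = z * M x y.
Proof. by rewrite mxE. Qed.

Lemma tens1E a c b d :
  (1%:M : 'M[A]_(N * N)) (ti a c) (ti b d) = ((a == b) && (c == d))%:R.
Proof. by rewrite mxE (can_eq (@mxtens_indexK _ _)) xpair_eqE. Qed.

Lemma ptrmx1 : ptrmx 1%:M = 1%:M.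
Proof.
by apply: tensmxP => a c b d; rewrite ptrmxE !tens1E [b == a]eq_sym.
Qed.

(* Exchange of the two tensor factors: M_12 |-> M_21. *)
Definition flipmx M : 'M[A]_(N * N) :=
  \matrix_(x, y) M (ti (mxtens_unindex x).2 (mxtens_unindex x).1)
                   (ti (mxtens_unindex y).2 (mxtens_unindex y).1).

Lemma flipmxE M a c b d : flipmx M (ti a c) (ti b d) = M (ti c a) (ti d b).
Proof. by rewrite mxE !mxtens_indexK. Qed.

Lemma flipmxM M M' : flipmx (M *m M') = flipmx M *m flipmx M'.
Proof.
apply: tensmxP => a c b d; rewrite flipmxE !mulmx_tensE exchange_big.
by apply: eq_bigr => p _; apply: eq_bigr => q _; rewrite !flipmxE.
Qed.

Lemma flipmx_in1 X : flipmx X _1 = X _2.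
Proof.
by apply: tensmxP => a c b d; rewrite flipmxE !tensmxE !mxE commr_nat.
Qed.

Lemma flipmx_in2 X : flipmx X _2 = X _1.
Proof.
by apply: tensmxP => a c b d; rewrite flipmxE !tensmxE !mxE commr_nat.
Qed.

Lemma flipmxK M : flipmx (flipmx M) = M.
Proof. by apply: tensmxP => a c b d; rewrite !flipmxE. Qed.

(** Exchanging the factors turns [M]^(u_1) into ([M]_21)^(u_2). If [M]_21 is the full transpose of
    [M], the two transpositions in the second factor cancel. *)
Lemma flip_ptrmx M : M^T = flipmx M -> flipmx (ptrmx M) = ptrmx M.
Proof.
move=> trM; apply: tensmxP => a c b d; rewrite flipmxE !ptrmxE.
by have := congr1 (fun P : 'M__ => P (ti c b) (ti d a)) trM; rewrite flipmxE mxE.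
Qed.

(** Transposition does not reverse products over a noncommutative ring. The identities below hold
    because the entries of R and J are central, while those of [X] and [Y] never change their
    order. *)
Definition central_mx m n (M : 'M[A]_(m, n)) :=
  forall x y z, M x y * z = z * M x y.

Lemma mul_in1_in2E X Y a c b d :
  (X _1 *m Y _2) (ti a c) (ti b d) = X a b * Y c d.
Proof.
rewrite mul_in1mxE (bigD1 b) //= tensmxE mxE eqxx mul1r big1 ?addr0 // => p pb.
by rewrite tensmxE mxE (negPf pb) mul0r mulr0.
Qed.

Lemma mul_in2_in1E X Y a c b d :
  (Y _2 *m X _1) (ti a c) (ti b d) = Y c d * X a b.
Proof.
rewrite mul_in2mxE (bigD1 d) //= tensmxE mxE eqxx mulr1 big1 ?addr0 // => p pd.
by rewrite tensmxE mxE (negPf pd) !mulr0.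
Qed.

Lemma comm_in1_in2 X Y : central_mx Y -> X _1 *m Y _2 = Y _2 *m X _1.
Proof.
by move=> cY; apply: tensmxP => a c b d; rewrite mul_in1_in2E mul_in2_in1E cY.
Qed.

(** Transposing the first factor moves [X] to the other side of [M]. The entries of [X] still stand
    to the left of those of [Y], so only the entries of [M] have to commute past others. *)
Lemma ptrmx_mul_in1_in2 M X Y : central_mx M ->
  ptrmx (M *m X _1 *m Y _2) = X^T _1 *m ptrmx M *m Y _2.
Proof.
move=> cM; apply: tensmxP => a c b d; rewrite ptrmxE !tensE.
apply: eq_bigr => q _; rewrite !tensE; congr (_ * _).
by apply: eq_bigr => p _; rewrite ptrmxE mxE cM.
Qed.

Lemma ptrmx_in2_in1_mul M X Y : central_mx M ->
  ptrmx (Y _2 *m X _1 *m M) = Y _2 *m ptrmx M *m X^T _1.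
Proof.
move=> cM; apply: tensmxP => a c b d.
rewrite ptrmxE -mulmxA !tensE.
under eq_bigr do rewrite tensE mulr_sumr.
under [RHS]eq_bigr do rewrite tensE mulr_suml.
rewrite exchange_big; apply: eq_bigr => p _; apply: eq_bigr => q _ /=.
by rewrite ptrmxE !mxE -mulrA cM.
Qed.

(** The full transpose keeps [X] before [Y]: they act on different tensor factors, so each entry of
    the product is a sum of terms with the [X] entry to the left of the [Y] entry. *)
Lemma trmx_mul_in1_in2 M X Y : central_mx M ->
  (M *m X _1 *m Y _2)^T = X^T _1 *m Y^T _2 *m M^T.
Proof.
move=> cM; apply: tensmxP => a c b d.
rewrite mxE -(mulmxA (X^T _1)) !tensE.
under eq_bigr do rewrite tensE mulr_suml.
under [RHS]eq_bigr do rewrite tensE mulr_sumr.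
rewrite exchange_big; apply: eq_bigr => p _; apply: eq_bigr => q _ /=.
by rewrite !mxE cM -mulrA cM mulrA.
Qed.

Lemma trmx_in2_in1_mul M X Y : central_mx M ->
  (Y _2 *m X _1 *m M)^T = M^T *m Y^T _2 *m X^T _1.
Proof.
move=> cM; apply: tensmxP => a c b d.
rewrite mxE -mulmxA tensE.
under eq_bigr do rewrite tensE mulr_sumr.
rewrite tensE.
under [RHS]eq_bigr do rewrite tensE mulr_suml.
rewrite exchange_big; apply: eq_bigr => p _; apply: eq_bigr => q _ /=.
by rewrite !mxE -[RHS]mulrA cM mulrA.
Qed.

(** Transposing the mixed relation in the first factor shows how [Tb]^u passes [T] across R^(u_1);
    transposing the relation for [Tb] completely gives its analogue for [Tb]^u. These and the
    relation for [T] carry R through the product until R, J_1, R^(u_1) and J_2 are adjacent; the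
    equation for [J] applies there, and the remaining factors are moved back in the same way. *)
Lemma reflection_equation (R : 'M[A]_(N * N)) (J T Tb : 'M[A]_N) :
    central_mx R -> central_mx J -> R^T = flipmx R ->
    R *m J _1 *m ptrmx R *m J _2 = J _2 *m ptrmx R *m J _1 *m R ->
    R *m T _1 *m T _2 = T _2 *m T _1 *m R ->
    R *m Tb _1 *m Tb _2 = Tb _2 *m Tb _1 *m R ->
    R *m Tb _1 *m T _2 = T _2 *m Tb _1 *m R ->
  let S := T *m J *m Tb^T in
  R *m S _1 *m ptrmx R *m S _2 = S _2 *m ptrmx R *m S _1 *m R.
Proof.
move=> cR cJ trR RJ RTT RTbTb RTbT S; set Rt := ptrmx R in RJ *.
have TbRT : Tb^T _1 *m Rt *m T _2 = T _2 *m Rt *m Tb^T _1.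
  by rewrite -ptrmx_mul_in1_in2 // RTbT ptrmx_in2_in1_mul.
have TbRT' : Tb^T _2 *m Rt *m T _1 = T _1 *m Rt *m Tb^T _2.
  by have := congr1 flipmx TbRT; rewrite !flipmxM !flipmx_in1 !flipmx_in2 flip_ptrmx.
have TbTbR : R *m Tb^T _1 *m Tb^T _2 = Tb^T _2 *m Tb^T _1 *m R.
  have := congr1 trmx RTbTb; rewrite trmx_mul_in1_in2 // trmx_in2_in1_mul //.
  by move/(congr1 flipmx); rewrite trR !flipmxM !flipmx_in1 !flipmx_in2 flipmxK.
have CJ1 X : X _2 *m J _1 = J _1 *m X _2.
  have := congr1 flipmx (@comm_in1_in2 X J cJ).
  by rewrite !flipmxM flipmx_in1 flipmx_in2.
have CJ2 X : X _1 *m J _2 = J _2 *m X _1 by apply: comm_in1_in2.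
rewrite /S !in1M !in2M -!mulmxA.
(* All products are nested to the right; [tl] and [tl2] apply an identity of three or two factors in
   front of an arbitrary tail. *)
have tl (M1 M2 M3 L1 L2 L3 : 'M[A]_(N * N)) : M1 *m M2 *m M3 = L1 *m L2 *m L3 ->
  forall M, M1 *m (M2 *m (M3 *m M)) = L1 *m (L2 *m (L3 *m M)).
  by move=> E M; rewrite !mulmxA E.
have tl2 (M1 M2 L1 L2 : 'M[A]_(N * N)) : M1 *m M2 = L1 *m L2 ->
  forall M, M1 *m (M2 *m M) = L1 *m (L2 *m M).
  by move=> E M; rewrite !mulmxA E.
have RJt M : R *m (J _1 *m (Rt *m (J _2 *m M))) =
             J _2 *m (Rt *m (J _1 *m (R *m M))).
  by rewrite !mulmxA RJ.
rewrite (tl _ _ _ _ _ _ TbRT) -(tl2 _ _ _ _ (CJ1 T)) (tl _ _ _ _ _ _ RTT).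
rewrite (tl2 _ _ _ _ (CJ2 _)) RJt.
have -> : R *m (Tb^T _1 *m Tb^T _2) = Tb^T _2 *m (Tb^T _1 *m R).
  by rewrite !mulmxA TbTbR.
by rewrite -(tl2 _ _ _ _ (CJ1 _)) (tl2 _ _ _ _ (CJ2 _)) -(tl _ _ _ _ _ _ TbRT').
Qed.

(** On each side one matrix is expanded in full, and the second only in the term without [h]. The
    result is therefore an exact multiple of [h], with a full [Rt] or [R] left in two of the
    terms. *)
Lemma deformed_commutator (h : A) (R r Rt rt S1 S2 : 'M[A]_(N * N)) :
    (forall x, h * x = x * h) -> R = 1%:M - h *: r -> Rt = 1%:M - h *: rt ->
    R *m S1 *m Rt *m S2 = S2 *m Rt *m S1 *m R ->
  S1 *m S2 - S2 *m S1 =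
    h *: (r *m S1 *m Rt *m S2 + S1 *m rt *m S2
          - S2 *m rt *m S1 *m R - S2 *m S1 *m r).
Proof.
move=> hC RE RtE E.
have hr m n p (X : 'M[A]_(m, n)) (Y : 'M[A]_(n, p)) : X *m (h *: Y) = h *: (X *m Y).
  apply/matrixP => x y; rewrite !mxE mulr_sumr; apply: eq_bigr => z _.
  by rewrite mxE !mulrA hC.
have LE : R *m S1 *m Rt *m S2 =
    S1 *m S2 - h *: (S1 *m rt *m S2) - h *: (r *m S1 *m Rt *m S2).
  rewrite {1}RE !mulmxBl mul1mx -!scalemxAl; congr (_ - _).
  by rewrite RtE mulmxBr mulmxBl mulmx1 hr -scalemxAl.
have RE' : S2 *m Rt *m S1 *m R =
    S2 *m S1 - h *: (S2 *m S1 *m r) - h *: (S2 *m rt *m S1 *m R).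
  rewrite {1}RtE mulmxBr mulmx1 hr !mulmxBl -!scalemxAl; congr (_ - _).
  by rewrite RE mulmxBr mulmx1 hr.
move/eqP: E; rewrite LE RE' -subr_eq0 => /eqP E.
apply: subr0_eq; rewrite -E !(scalerDr, scalerN) !(opprD, opprK) !addrA.
by rewrite [LHS](ACl (1*4*3*2*6*5)).
Qed.

(** The commutator of S_1 and S_2 after division by [h]. Stated over any ring, it can be computed in
    U'_A and then mapped to P_n. *)
Definition bracket_mx (r R : 'M[A]_(N * N)) (S : 'M[A]_N) :=
  r *m S _1 *m ptrmx R *m S _2 + S _1 *m ptrmx r *m S _2
  - S _2 *m ptrmx r *m S _1 *m R - S _2 *m S _1 *m r.

Lemma bracket_mx1 r (S : 'M[A]_N) :
  bracket_mx r 1%:M S =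
  r *m S _1 *m S _2 + S _1 *m ptrmx r *m S _2
  - S _2 *m ptrmx r *m S _1 - S _2 *m S _1 *m r.
Proof. by rewrite /bracket_mx ptrmx1 !mulmx1. Qed.

Lemma bracket_mxE (h : A) (r R : 'M[A]_(N * N)) (S : 'M[A]_N)
    (i j k l : 'I_N) :
    (forall x, h * x = x * h) -> R = 1%:M - h *: r ->
    R *m S _1 *m ptrmx R *m S _2 = S _2 *m ptrmx R *m S _1 *m R ->
  S i j * S k l - S k l * S i j =
    h * bracket_mx r R S (ti i k) (ti j l).
Proof.
move=> hC RE reflS; have RtE : ptrmx R = 1%:M - h *: ptrmx r.
  by rewrite -[in RHS]ptrmx1 RE; apply: tensmxP => a c b d; rewrite !mxE !mxtens_indexK.
have := deformed_commutator hC RE RtE reflS.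
move/(congr1 (fun M : 'M__ => M (ti i k) (ti j l))).
by rewrite mxDE mxNE mul_in1_in2E mul_in2_in1E [RHS]mxE.
Qed.

End TensorSquare.

(** * Ring morphisms applied entrywise *)

Section MapTensor.
Variables (A B : pzRingType) (f : {rmorphism A -> B}) (N : nat).
Implicit Types M : 'M[A]_(N * N).
Local Notation "X '_1'" := (X *t (1%:M : 'M_N)) (at level 2).
Local Notation "X '_2'" := ((1%:M : 'M_N) *t X) (at level 2).

Lemma map_ptrmx M : map_mx f (ptrmx M) = ptrmx (map_mx f M).
Proof. by apply/matrixP => x y; rewrite !mxE. Qed.

Lemma map_flipmx M : map_mx f (flipmx M) = flipmx (map_mx f M).
Proof. by apply/matrixP => x y; rewrite !mxE. Qed.

Lemma map_in1 (X : 'M[A]_N) : map_mx f X _1 = (map_mx f X) _1.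
Proof. by rewrite map_mxT map_mx1. Qed.

Lemma map_in2 (X : 'M[A]_N) : map_mx f X _2 = (map_mx f X) _2.
Proof. by rewrite map_mxT map_mx1. Qed.

Lemma map_intertwine M (X Y : 'M[A]_N) :
    (forall i j, f ((M *m X _1 *m Y _2) i j) =
                 f ((Y _2 *m X _1 *m M) i j)) ->
  map_mx f M *m (map_mx f X) _1 *m (map_mx f Y) _2 =
  (map_mx f Y) _2 *m (map_mx f X) _1 *m map_mx f M.
Proof.
rewrite -map_in1 -map_in2 -!map_mxM => MXY.
by apply/matrixP => i j; rewrite [LHS]mxE [RHS]mxE MXY.
Qed.

Lemma map_reflection_l M (X Y : 'M[A]_N) :
  map_mx f (M *m X _1 *m ptrmx M *m Y _2) =
  map_mx f M *m (map_mx f X) _1 *m ptrmx (map_mx f M) *m (map_mx f Y) _2.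
Proof. by rewrite !map_mxM map_in1 map_in2 map_ptrmx. Qed.

Lemma map_reflection_r M (X Y : 'M[A]_N) :
  map_mx f (Y _2 *m ptrmx M *m X _1 *m M) =
  (map_mx f Y) _2 *m ptrmx (map_mx f M) *m (map_mx f X) _1 *m map_mx f M.
Proof. by rewrite !map_mxM map_in1 map_in2 map_ptrmx. Qed.

Lemma map_bracket_mx (r R : 'M[A]_(N * N)) (S : 'M[A]_N) :
  map_mx f (bracket_mx r R S) =
  bracket_mx (map_mx f r) (map_mx f R) (map_mx f S).
Proof.
by rewrite /bracket_mx !(map_mxB, map_mxD, map_mxM) !map_in1 !map_in2 !map_ptrmx.
Qed.

End MapTensor.

(** * The symplectic R-matrix *)

Section Signs.
Variable n : nat.
Local Notation N := (2 * n)%N.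
Implicit Types i j : 'I_N.

Lemma eps_rev (A : pzRingType) i : eps A (rev_ord i) = - eps A i.
Proof.
have ltiN := ltn_ord i; rewrite /eps /=.
case: (ltnP i n) => lin; first by rewrite ifF //; lia.
by rewrite ifT ?opprK //; lia.
Qed.

Lemma eps_sqr (A : pzRingType) i : eps A i * eps A i = 1.
Proof. by rewrite /eps; case: ifP => _; rewrite ?mulrNN mulr1. Qed.

Lemma eps_comm (A : pzRingType) i (x : A) : eps A i * x = x * eps A i.
Proof. by rewrite /eps; case: ifP => _; rewrite ?mulN1r ?mulrN1 ?mul1r ?mulr1. Qed.

Lemma rmorph_eps (A B : pzRingType) (f : {rmorphism A -> B}) i :
  f (eps A i) = eps B i.
Proof. by rewrite /eps; case: ifP => _; rewrite ?rmorphN1 ?rmorph1. Qed.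

Lemma rho_rev i : rho (rev_ord i) = - rho i.
Proof.
have ltiN := ltn_ord i; rewrite /rho /=.
case: (ltnP i n) => lin; first by rewrite ifF; lia.
by rewrite ifT; lia.
Qed.

Lemma rev_ord_neq i : (rev_ord i == i) = false.
Proof. by apply/eqP => /(congr1 val) /=; have := ltn_ord i; lia. Qed.

Lemma ltn_rev i j : (rev_ord i < rev_ord j)%N = (j < i)%N.
Proof. by move=> /=; have := ltn_ord i; have := ltn_ord j; lia. Qed.

Lemma rev_ord_swap i j : (i == rev_ord j) = (j == rev_ord i).
Proof. by rewrite -(inj_eq rev_ord_inj) rev_ordK eq_sym. Qed.

Lemma sum2_delta (A : nmodType) (F : 'I_N -> 'I_N -> A) a b :
  \sum_p \sum_q F p q *+ ((p == a) && (q == b)) = F a b.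
Proof.
rewrite (bigD1 a) //= (bigD1 b) //= !eqxx !big1 ?addr0 // => [p pa|p pb].
  by rewrite big1 // => r _; rewrite (negPf pa).
by rewrite (negPf pb) andbF.
Qed.

(* The quotient (R - 1) / (q - 1), with [t z] in the role of [q ^ z]. *)
Definition dR_entry (A : pzRingType) (t : int -> A) (a c b d : 'I_N) : A :=
  ((a == c)%:R - (a == rev_ord c)%:R * t (-1)) *+ ((a == b) && (c == d))
  + (1 + t (-1)) *+ [&& (a < b)%N, c == b & d == a]
  - ((1 + t (-1)) * (t (rho b - rho a) * eps A a * eps A b))
      *+ [&& (a < b)%N, c == rev_ord a & d == rev_ord b].

Definition dR (A : pzRingType) (t : int -> A) : 'M[A]_(N * N) :=
  \matrix_(x, y) dR_entry t (mxtens_unindex x).1 (mxtens_unindex x).2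
                            (mxtens_unindex y).1 (mxtens_unindex y).2.

Lemma dRE (A : pzRingType) (t : int -> A) a c b d :
  dR t (ti a c) (ti b d) = dR_entry t a c b d.
Proof. by rewrite mxE !mxtens_indexK. Qed.

(** The powers of q enter through the function [t], so that one formula serves over C(q) and
    C[q, q^-1], and at q = 1 with [t] constantly 1. *)
Lemma map_dR (A B : pzRingType) (f : {rmorphism A -> B}) (t : int -> A) :
  map_mx f (dR t) = dR (f \o t).
Proof.
apply: tensmxP => a c b d; rewrite mxE !dRE /dR_entry.
by rewrite !(rmorphB, rmorphD, rmorphMn, rmorphM, rmorph_nat, rmorph1, rmorph_eps).
Qed.

Definition Jsp (A : pzRingType) : 'M[A]_N := \matrix_(i, j) (eps A i *+ (i == j)).

(** The term of index k in the entry can be nonzero only for j <= k <= i. Together with i <= j this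
    leaves k = i = j. *)
Lemma triangular_mul_Jsp (A : pzRingType) (T Tb : 'M[A]_N) (i j : 'I_N) :
    (forall i j : 'I_N, (i < j)%N -> T i j = 0) ->
    (forall i j : 'I_N, (i < j)%N -> Tb j i = 0) ->
    (forall i, T i i * Tb i i = 1) -> (i <= j)%N ->
  (T *m Jsp A *m Tb^T) i j = if i == j then eps A i else 0.
Proof.
move=> T0 Tb0 TTb ij.
have -> : (T *m Jsp A *m Tb^T) i j = \sum_k T i k * eps A k * Tb j k.
  rewrite mxE; apply: eq_bigr => k _; rewrite [Tb^T _ _]mxE; congr (_ * _).
  rewrite mxE (bigD1 k) //= [Jsp _ _ _]mxE eqxx big1 ?addr0 // => m mk.
  by rewrite [Jsp _ _ _]mxE (negPf mk) mulr0.
case: (eqVneq i j) => [<-|i_j].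
  rewrite (bigD1 i) //= big1 ?addr0 => [|k ki].
    by rewrite -mulrA eps_comm mulrA TTb mul1r.
  case: (ltngtP i k) => [ik|ki'|/val_inj ik].
  - by rewrite T0 // !mul0r.
  - by rewrite Tb0 // mulr0.
  - by rewrite ik eqxx in ki.
rewrite big1 // => k _; have [ik|ki] := ltnP i k; first by rewrite T0 // !mul0r.
rewrite Tb0 ?mulr0 //; apply: leq_ltn_trans ki _.
by rewrite ltn_neqAle -val_eqE /= in i_j *; rewrite i_j.
Qed.

Lemma map_Jsp (A B : pzRingType) (f : {rmorphism A -> B}) :
  map_mx f (Jsp A) = Jsp B.
Proof. by apply/matrixP => i j; rewrite !mxE rmorphMn rmorph_eps. Qed.

End Signs.

(** * The R-matrix over a field and the reflection equation for J *)

Section QuantumR.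
Variables (F : fieldType) (q : F) (n : nat).
Local Notation N := (2 * n)%N.
Local Notation eps := (@eps n F).

Definition qR_entry (a c b d : 'I_N) : F :=
  q ^ ((a == c)%:Z - (a == rev_ord c)%:Z) *+ ((a == b) && (c == d))
  + (q - q^-1) *+ [&& (a < b)%N, c == b & d == a]
  - (q - q^-1) * (q ^ (rho b - rho a) * eps a * eps b)
      *+ [&& (a < b)%N, c == rev_ord a & d == rev_ord b].

Definition qR : 'M[F]_(N * N) :=
  \matrix_(x, y) qR_entry (mxtens_unindex x).1 (mxtens_unindex x).2
                          (mxtens_unindex y).1 (mxtens_unindex y).2.
Local Notation Rm := qR.

Lemma qRE a c b d : Rm (ti a c) (ti b d) = qR_entry a c b d.
Proof. by rewrite mxE !mxtens_indexK. Qed.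

Lemma sum_delta_mx_qR :
  \sum_(i < N) \sum_(j < N) q ^ ((i == j)%:Z - (i == rev_ord j)%:Z)
    *: (delta_mx i i *t delta_mx j j)
  + (q - q^-1) *:
    (\sum_(i < N) \sum_(j < N | (i < j)%N) delta_mx i j *t delta_mx j i)
  - (q - q^-1) *:
    (\sum_(i < N) \sum_(j < N | (i < j)%N)
      (q ^ (rho j - rho i) * eps i * eps j)
        *: (delta_mx i j *t delta_mx (rev_ord i) (rev_ord j))) = Rm.
Proof.
apply: tensmxP => a c b d; rewrite qRE.
have tE (i j k l : 'I_N) : (delta_mx i j *t delta_mx k l : 'M[F]_(N * N))
    (ti a c) (ti b d) = [&& a == i, b == j, c == k & d == l]%:R.
  by rewrite tensmxE !mxE -natrM mulnb -!andbA.
rewrite !(mxDE, mxNE, mxZE) !summxE; congr (_ + _ - _).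
- rewrite (bigD1 a) //= summxE (bigD1 c) //= mxZE tE.
  rewrite !big1 ?addr0 => [|j ja|j jc].
  + by rewrite !eqxx /= [b == a]eq_sym [d == c]eq_sym mulr_natr.
  + by rewrite summxE big1 // => k _; rewrite mxZE tE [a == j]eq_sym (negPf ja) mulr0.
  + by rewrite mxZE tE [c == j]eq_sym (negPf jc) !andbF mulr0.
- rewrite -mulr_natr; congr (_ * _).
  rewrite (bigD1 a) //= [X in _ + X]big1 ?addr0 => [|j ja]; last first.
    by rewrite summxE big1 // => k _; rewrite tE [a == j]eq_sym (negPf ja).
  rewrite summxE big_mkcond (bigD1 b) //= big1 ?addr0.
    by rewrite tE !eqxx /=; case: ifP.
  by move=> j jb; rewrite tE [b == j]eq_sym (negPf jb) andbF if_same.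
- rewrite -mulrnAr; congr (_ * _).
  rewrite (bigD1 a) //= [X in _ + X]big1 ?addr0 => [|j ja]; last first.
    by rewrite summxE big1 // => k _; rewrite mxZE tE [a == j]eq_sym (negPf ja) mulr0.
  rewrite summxE big_mkcond (bigD1 b) //= big1 ?addr0.
    by rewrite mxZE tE !eqxx /=; case: ifP; rewrite ?mulr0n // => _; rewrite mulr_natr.
  by move=> j jb; rewrite mxZE tE [b == j]eq_sym (negPf jb) andbF mulr0 if_same.
Qed.

(** The three sums of R can be compared separately. For the last one, the pair (i, j) is matched
    with (j', i'), which preserves the order, the exponent and the product of signs. *)
Lemma trmx_qR : Rm^T = flipmx Rm.
Proof.
apply: tensmxP => a c b d; rewrite flipmxE mxE !qRE /qR_entry; congr (_ + _ - _).
- rewrite [c == d]eq_sym [a == b]eq_sym andbC.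
  case: (eqVneq b a) => [->|]; rewrite ?andbF //= andbT.
  case: (eqVneq d c) => [->|] //=.
  by rewrite [a == c]eq_sym [a == rev_ord c]rev_ord_swap.
- congr (_ *+ nat_of_bool _); rewrite [a == d]eq_sym [b == c]eq_sym.
  by case: eqVneq => [->|]; rewrite ?andbF //; case: eqVneq => [->|]; rewrite ?andbF.
- rewrite [a == rev_ord c]rev_ord_swap [b == rev_ord d]rev_ord_swap.
  case: (eqVneq d (rev_ord b)) => [->|]; rewrite ?andbF //.
  case: (eqVneq c (rev_ord a)) => [->|]; rewrite ?andbF //.
  by rewrite ltn_rev !rho_rev !eps_rev !(mulrN, mulNr) !opprK [- _ + _]addrC mulrAC.
Qed.

(* If [e p r] is the column [(p, r)] of a matrix M, then [qR_col e a b] is the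
   column [(a, b)] of [M *m qR]; [JRJ_col] plays the same role for
   J_1 R^(u_1) J_2. *)
Definition qR_col (e : 'I_N -> 'I_N -> F) (a b : 'I_N) : F :=
  q ^ ((a == b)%:Z - (a == rev_ord b)%:Z) * e a b
  + (q - q^-1) * (b < a)%N%:R * e b a
  - (q - q^-1) * (a == rev_ord b)%:R *
      \sum_(i < N | (i < a)%N)
         q ^ (rho a - rho i) * eps i * eps a * e i (rev_ord i).

Definition JRJ_col (e : 'I_N -> 'I_N -> F) (a b : 'I_N) : F :=
  eps a * eps b * (q ^ ((a == b)%:Z - (a == rev_ord b)%:Z) * e a b
  - (q - q^-1) * (a < rev_ord b)%N%:R * q ^ (rho (rev_ord b) - rho a)
      * e (rev_ord b) (rev_ord a))
  + (q - q^-1) * (a == b)%:R *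
      \sum_(i < N | (a < i)%N) eps i * eps a * e i i.

(** The columns (a, b) split into the cases b = a, b = a' and all others. In each of the first two
    cases one of the operators acts as a scalar; in the last one both are explicit on at most four
    columns. *)
Lemma qR_col_JRJ_col e a b : qR_col (JRJ_col e) a b = JRJ_col (qR_col e) a b.
Proof.
(* On columns (j, j) the operator [qR_col] is multiplication by q, and [JRJ_col] involves only such
   columns. *)
have [<-|ab] := eqVneq a b.
  have Raa j : qR_col e j j = q * e j j.
    by rewrite /qR_col eqxx eq_sym rev_ord_neq ltnn !(mulr0, mul0r) subr0 addr0 expr1z.
  have Raa' j : qR_col (JRJ_col e) j j = q * JRJ_col e j j.
    by rewrite /qR_col eqxx eq_sym rev_ord_neq ltnn !(mulr0, mul0r) subr0 addr0 expr1z.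
  rewrite Raa' /JRJ_col !Raa.
  under [in RHS]eq_bigr do rewrite Raa mulrCA.
  rewrite -mulr_sumr; ring.
(* On columns (j, j') the roles are exchanged: [JRJ_col] is multiplication by -q^-1, and [qR_col]
   stays among such columns. *)
have [->|ab'] := eqVneq b (rev_ord a).
  have KE f j : JRJ_col f j (rev_ord j) = - (q ^ (-1) * f j (rev_ord j)).
    rewrite /JRJ_col rev_ordK ltnn eqxx eq_sym rev_ord_neq eps_rev.
    by rewrite mulrN eps_sqr !(mulr0, mul0r) subr0 addr0 mulN1r sub0r.
  have KE' f j : JRJ_col f (rev_ord j) j = - (q ^ (-1) * f (rev_ord j) j).
    by have := KE f (rev_ord j); rewrite rev_ordK.
  rewrite KE /qR_col !KE KE'.
  under eq_bigr do rewrite KE mulrN mulrCA.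
  rewrite sumrN -mulr_sumr; ring.
(* Here only the columns (a, b), (b, a), (b', a') and (a', b') occur. The two operators commute
   because a < b' is equivalent to b < a' and rho_(b') - rho_a = rho_(a') - rho_b. *)
have KE f j k : j != k -> k != rev_ord j -> JRJ_col f j k =
    eps j * eps k * (f j k - (q - q^-1) * (j < rev_ord k)%N%:R
      * q ^ (rho (rev_ord k) - rho j) * f (rev_ord k) (rev_ord j)).
  by move=> jk jk'; rewrite /JRJ_col (negPf jk) rev_ord_swap (negPf jk');
    rewrite mulr0 mul0r addr0 expr0z mul1r.
have RE f j k : j != k -> k != rev_ord j -> qR_col f j k = f j k +
   (q - q^-1) * (k < j)%N%:R * f k j.
  by move=> jk jk'; rewrite /qR_col (negPf jk) rev_ord_swap (negPf jk');
    rewrite mulr0 mul0r subr0 expr0z mul1r.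
have ba : b != a by rewrite eq_sym.
have ba' : a != rev_ord b by rewrite rev_ord_swap.
rewrite KE // !RE // ?(inj_eq rev_ord_inj) ?rev_ordK ?[rev_ord b == a]eq_sym //.
have ltba : (b < rev_ord a)%N = (a < rev_ord b)%N by rewrite -ltn_rev rev_ordK.
rewrite !KE // !ltn_rev ltba !rho_rev [- rho b - _]addrC; ring.
Qed.

Lemma mulmx_qR m (M : 'M[F]_(m, N * N)) x a b :
  (M *m Rm) x (ti a b) = qR_col (fun p r => M x (ti p r)) a b.
Proof.
have -> : (M *m Rm) x (ti a b) =
    \sum_p \sum_r (M x (ti p r) * q ^ ((p == r)%:Z - (p == rev_ord r)%:Z)
                      *+ ((p == a) && (r == b)))
  + \sum_p \sum_r (M x (ti p r) * ((q - q^-1) * (b < a)%N%:R)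
                      *+ ((p == b) && (r == a)))
  - \sum_p \sum_r (M x (ti p r) * ((q - q^-1) * (q ^ (rho a - rho p) * eps p * eps a))
                      *+ [&& (p < a)%N, r == rev_ord p & a == rev_ord b]).
  rewrite mxE sum_tens -big_split -sumrB /=; apply: eq_bigr => p _.
  rewrite -big_split -sumrB /=; apply: eq_bigr => r _.
  rewrite qRE /qR_entry mulrBr mulrDr !mulrnAr; congr (_ + _ - _ *+ _).
    rewrite mulr1 -mulrnA mulnb [p == b]eq_sym; congr (_ *+ nat_of_bool _).
    by case: (eqVneq b p) => [->|]; rewrite ?andbF ?andbT.
  by rewrite [b == _]rev_ord_swap.
rewrite !sum2_delta /qR_col; congr (_ + _ - _).
- by rewrite mulrC.
- by rewrite mulrC.
- rewrite mulr_sumr [RHS]big_mkcond; apply: eq_bigr => p _.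
  rewrite (bigD1 (rev_ord p)) //= eqxx big1 ?addr0 => [|r rp]; last first.
    by rewrite (negPf rp) andbF.
  case: ifP => // _ /=; rewrite -mulr_natr; ring.
Qed.

Local Notation J := (Jsp n F).
Local Notation "X '_1'" := (X *t (1%:M : 'M[F]_N)) (at level 2).
Local Notation "X '_2'" := ((1%:M : 'M[F]_N) *t X) (at level 2).

Lemma mulmx_J (g : 'I_N -> F) b : \sum_p g p * J p b = g b * eps b.
Proof.
rewrite (bigD1 b) //= mxE eqxx big1 ?addr0 // => p pb.
by rewrite mxE (negPf pb) mulr0.
Qed.

Lemma mul_Jmx (g : 'I_N -> F) b : \sum_p J b p * g p = eps b * g b.
Proof.
rewrite (bigD1 b) //= mxE eqxx big1 ?addr0 // => p pb.
by rewrite mxE eq_sym (negPf pb) mul0r.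
Qed.

Definition JRJ_entry (p r a b : 'I_N) : F :=
  (eps a * eps b * q ^ ((p == r)%:Z - (p == rev_ord r)%:Z)) *+ ((p == a) && (r == b))
  - eps a * eps b * ((q - q^-1) * (a < rev_ord b)%N%:R * q ^ (rho (rev_ord b) - rho a))
     *+ ((p == rev_ord b) && (r == rev_ord a))
  + (q - q^-1) * (a == b)%:R * (eps p * eps a) *+ ((a < p)%N && (r == p)).

Lemma JRJE p r a b :
  (J _1 *m ptrmx Rm *m J _2) (ti p r) (ti a b) = JRJ_entry p r a b.
Proof.
rewrite -mulmxA mul_in1mxE mul_Jmx mulmx_in2E mulmx_J ptrmxE qRE /qR_entry /JRJ_entry.
rewrite [b == rev_ord p]rev_ord_swap.
rewrite mulrBl mulrDl mulrBr mulrDr -!addrA; congr (_ + _).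
  rewrite -mulr_natr -[RHS]mulr_natr [a == p]eq_sym.
  case: (eqVneq p a) => [->|_]; last by rewrite !(mulr0n, mulr0, mul0r).
  case: (eqVneq r b) => [->|_]; last by rewrite !(mulr0n, mulr0, mul0r).
  ring.
rewrite addrC; congr (- _ + _).
  case: (eqVneq p (rev_ord b)) => [->|_]; last by rewrite !andbF !(mulr0n, mul0r, mulr0).
  case: (eqVneq r (rev_ord a)) => [_|_]; last by rewrite !andbF !(mulr0n, mul0r, mulr0).
  rewrite !andbT eps_rev; case: (_ < _)%N; last by rewrite !(mulr0n, mul0r, mulr0).
  by rewrite !mulr1n mulr1 -[RHS]mul1r -(eps_sqr F b); ring.
rewrite [a == b]eq_sym; case: (eqVneq b a) => [->|_]; last first.
  by rewrite !andbF !(mulr0n, mulr0, mul0r) mul0rn.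
by rewrite andbT; case: (_ && _); rewrite ?mulr1n ?(mulr0n, mulr0, mul0r) //; ring.
Qed.

(** The two products differ by the signs eps_p eps_b and eps_r eps_a. These agree wherever the entry
    of R^(u_1) is nonzero, as each of the three sums of R shows. *)
Lemma JRJ_swapE p r a b :
  (J _2 *m ptrmx Rm *m J _1) (ti p r) (ti a b) = JRJ_entry p r a b.
Proof.
rewrite -JRJE -!mulmxA mul_in1mxE mul_in2mxE !mul_Jmx.
rewrite mulmx_in1E mulmx_in2E !mulmx_J !ptrmxE.
suff E : Rm (ti a r) (ti p b) * (eps r * eps a) = Rm (ti a r) (ti p b) * (eps p * eps b).
  by rewrite [LHS]mulrCA E mulrCA.
rewrite qRE /qR_entry [LHS]mulrBl [RHS]mulrBl; congr (_ - _).
  rewrite [LHS]mulrDl [RHS]mulrDl; congr (_ + _).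
    case: (eqVneq a p) => [->|_]; last by rewrite /= !(mulr0n, mul0r).
    case: (eqVneq r b) => [->|_]; last by rewrite /= !(mulr0n, mul0r).
    by rewrite mulrC [eps b * _]mulrC [RHS]mulrC.
  case: (eqVneq r p) => [->|_]; last by rewrite !andbF !(mulr0n, mul0r).
  by case: (eqVneq b a) => [->|_] //; rewrite !andbF !(mulr0n, mul0r).
case: (eqVneq r (rev_ord a)) => [->|_]; last by rewrite !andbF !(mulr0n, mul0r).
case: (eqVneq b (rev_ord p)) => [->|_]; last by rewrite !andbF !(mulr0n, mul0r).
by rewrite !eps_rev mulrN mulNr !eps_sqr.
Qed.

Lemma mulmx_JRJ m (M : 'M[F]_(m, N * N)) x a b :
  (M *m (J _1 *m ptrmx Rm *m J _2)) x (ti a b) = JRJ_col (fun p r => M x (ti p r)) a b.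
Proof.
have -> : (M *m (J _1 *m ptrmx Rm *m J _2)) x (ti a b) =
    \sum_p \sum_r (M x (ti p r) * (eps a * eps b * q ^ ((p == r)%:Z - (p == rev_ord r)%:Z))
                      *+ ((p == a) && (r == b)))
  - \sum_p \sum_r (M x (ti p r) * (eps a * eps b * ((q - q^-1) * (a < rev_ord b)%N%:R
                                           * q ^ (rho (rev_ord b) - rho a)))
                      *+ ((p == rev_ord b) && (r == rev_ord a)))
  + \sum_p \sum_r (M x (ti p r) * ((q - q^-1) * (a == b)%:R * (eps p * eps a))
                      *+ ((a < p)%N && (r == p))).
  rewrite mxE sum_tens -sumrB -big_split /=; apply: eq_bigr => p _.
  rewrite -sumrB -big_split /=; apply: eq_bigr => r _.
  by rewrite JRJE /JRJ_entry mulrDr mulrBr !(mulrnAr (M _ _)).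
rewrite !sum2_delta /JRJ_col; congr (_ + _).
- ring.
- rewrite mulr_sumr [RHS]big_mkcond; apply: eq_bigr => p _.
  rewrite (bigD1 p) //= eqxx big1 ?addr0 => [|r rp]; last first.
    by rewrite (negPf rp) andbF.
  by rewrite andbT; case: ifP => // _ /=; rewrite ?mulr0n // mulr1n; ring.
Qed.

(** Since J_1 R^(u_1) J_2 = J_2 R^(u_1) J_1, the equation says that R commutes with this matrix.
    Applied to a row [e] of the identity, this is the commutation of [qR_col] and [JRJ_col]. *)
Lemma reflection_J :
  Rm *m J _1 *m ptrmx Rm *m J _2 = J _2 *m ptrmx Rm *m J _1 *m Rm.
Proof.
have -> : J _2 *m ptrmx Rm *m J _1 = J _1 *m ptrmx Rm *m J _2.
  by apply: tensmxP => a c b d; rewrite JRJE JRJ_swapE.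
rewrite -!(mulmxA Rm); apply/matrixP => x y; case: (mxtens_indexP y) => a b {y}.
rewrite mulmx_JRJ mulmx_qR.
pose e p r := (1%:M : 'M[F]_(N * N)) x (ti p r).
have -> : (fun p r => Rm x (ti p r)) = qR_col e.
  by apply/funext => p; apply/funext => r; rewrite -mulmx_qR mul1mx.
have -> : (fun p r => (J _1 *m ptrmx Rm *m J _2) x (ti p r)) = JRJ_col e.
  by apply/funext => p; apply/funext => r; rewrite -mulmx_JRJ mul1mx.
by rewrite qR_col_JRJ_col.
Qed.

Lemma qR_dR : q != 0 -> Rm = 1%:M - (1 - q) *: dR n (exprz q).
Proof.
move=> q0; apply: tensmxP => a c b d; rewrite qRE mxDE mxNE mxZE tens1E dRE.
rewrite /qR_entry /dR_entry exprN1.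
(* The exponent is 1, -1 or 0 because c and c' differ, and q^-1 = 1 + (1 - q) q^-1. *)
have -> : q ^ ((a == c)%:Z - (a == rev_ord c)%:Z) =
    1 - (1 - q) * ((a == c)%:R - (a == rev_ord c)%:R * q^-1).
  case: (eqVneq a c) => [->|_].
    by rewrite eq_sym rev_ord_neq mul0r !subr0 expr1z mulr1 opprB addrC subrK.
  case: eqP => _; last by rewrite mul0r !subr0 mulr0 subr0 expr0z.
  by rewrite !sub0r mul1r mulrN opprK mulrBl mul1r mulfV // addrC subrK exprN1.
have -> : q - q^-1 = - ((1 - q) * (1 + q^-1)).
  rewrite mulrDr mulr1 [_ * q^-1]mulrBl mul1r mulfV //; ring.
move: (_ - _ * q^-1) (1 + q^-1) (_ * _ * _) (1 - q) => x y z w.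
rewrite mulrBr mulrDr !mulrnAr mulrnBl !mulNr !mulNrn opprK !mulrA.
by rewrite !opprD opprK !addrA.
Qed.

End QuantumR.

Lemma Rmx_qR (R : realType) (n : nat) : Rmx n R = qR qC n.
Proof. exact: sum_delta_mx_qR. Qed.

(** * The classical limit *)

Section ClassicalR.
Variables (B : pzRingType) (n : nat).
Local Notation N := (2 * n)%N.
Local Notation eps := (@eps n B).
Local Notation "X '_1'" := (X *t (1%:M : 'M[B]_N)) (at level 2).
Local Notation "X '_2'" := ((1%:M : 'M[B]_N) *t X) (at level 2).

Definition rmat_entry (a c b d : 'I_N) : B :=
  ((a == c)%:R - (a == rev_ord c)%:R) *+ ((a == b) && (c == d))
  + 2 *+ [&& (a < b)%N, c == b & d == a]
  - (2 * (eps a * eps b)) *+ [&& (a < b)%N, c == rev_ord a & d == rev_ord b].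

Lemma rmat_entryC a c b d x : rmat_entry a c b d * x = x * rmat_entry a c b d.
Proof.
suff: GRing.comm x (rmat_entry a c b d) by move=> ->.
have comm_eps e : GRing.comm x (eps e) by rewrite /GRing.comm eps_comm.
by apply: commrB; [apply: commrD|]; apply: commrMn;
  do ?[apply: commrB|apply: commrM]; rewrite // /GRing.comm ?commr_nat.
Qed.

Lemma sum_rmat_row (F : 'I_N -> 'I_N -> B) a c :
  \sum_p \sum_q rmat_entry a c p q * F p q =
  ((a == c)%:R - (a == rev_ord c)%:R) * F a c
  + 2 * (a < c)%N%:R * F c a
  - 2 * (a == rev_ord c)%:R *
      \sum_(p < N | (a < p)%N) eps a * eps p * F p (rev_ord p).
Proof.
transitivity (
    \sum_p \sum_q (((a == c)%:R - (a == rev_ord c)%:R) * F p q) *+ ((p == a) && (q == c))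
  + \sum_p \sum_q (2 * (a < c)%N%:R * F p q) *+ ((p == c) && (q == a))
  - \sum_p \sum_q (2 * ((eps a * eps p) * F p q))
      *+ [&& (a < p)%N, c == rev_ord a & q == rev_ord p]).
  rewrite -big_split -sumrB /=; apply: eq_bigr => p _.
  rewrite -big_split -sumrB /=; apply: eq_bigr => q _.
  rewrite /rmat_entry mulrBl mulrDl; congr (_ + _ - _).
  - by rewrite mulrnAl [a == p]eq_sym [c == q]eq_sym.
  - case: (eqVneq c p) => [->|]; last by rewrite !andbF mulr0n mul0r.
    rewrite /=; case: (q == a); last by rewrite !andbF mulr0n mul0r.
    by rewrite !andbT; case: (a < p)%N; rewrite ?mulr0n ?mulr1n ?mulr1 // mulr0.
  - by rewrite [LHS]mulrnAl -!mulrA.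
rewrite !sum2_delta; congr (_ - _).
rewrite mulr_sumr [RHS]big_mkcond; apply: eq_bigr => p _.
rewrite (bigD1 (rev_ord p)) //= eqxx big1 ?addr0 => [|q qp]; last first.
  by rewrite (negPf qp) !andbF.
rewrite andbT rev_ord_swap; case: (a < p)%N => //.
by case: (a == rev_ord c); rewrite /= ?(mulr1n, mulr0n) ?mulr1 // mulr0 mul0r.
Qed.

Lemma sum_rmat_col (F : 'I_N -> 'I_N -> B) b d :
  \sum_p \sum_q rmat_entry p q b d * F p q =
  ((b == d)%:R - (b == rev_ord d)%:R) * F b d
  + 2 * (d < b)%N%:R * F d b
  - 2 * (d == rev_ord b)%:R *
      \sum_(p < N | (p < b)%N) eps p * eps b * F p (rev_ord p).
Proof.
transitivity (
    \sum_p \sum_q (((p == q)%:R - (p == rev_ord q)%:R) * F p q) *+ ((p == b) && (q == d))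
  + \sum_p \sum_q (2 * (d < b)%N%:R * F p q) *+ ((p == d) && (q == b))
  - \sum_p \sum_q (2 * ((eps p * eps b) * F p q))
      *+ [&& (p < b)%N, q == rev_ord p & d == rev_ord b]).
  rewrite -big_split -sumrB /=; apply: eq_bigr => p _.
  rewrite -big_split -sumrB /=; apply: eq_bigr => q _.
  rewrite /rmat_entry mulrBl mulrDl; congr (_ + _ - _).
  - by rewrite mulrnAl.
  - case: (eqVneq d p) => [->|]; last by rewrite !andbF mulr0n mul0r.
    rewrite /=; case: (q == b); last by rewrite !andbF mulr0n mul0r.
    by rewrite !andbT; case: (p < b)%N; rewrite ?mulr0n ?mulr1n ?mulr1 // mulr0.
  - by rewrite [LHS]mulrnAl -!mulrA.
rewrite !sum2_delta; congr (_ - _).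
rewrite mulr_sumr [RHS]big_mkcond; apply: eq_bigr => p _.
rewrite (bigD1 (rev_ord p)) //= eqxx big1 ?addr0 => [|q qp]; last first.
  by rewrite (negPf qp) !andbF.
case: (p < b)%N => //.
by case: (d == rev_ord b); rewrite /= ?(mulr1n, mulr0n) ?mulr1 // mulr0 mul0r.
Qed.

Definition rmat : 'M[B]_(N * N) := dR n (fun=> 1).

Lemma rmatE a c b d : rmat (ti a c) (ti b d) = rmat_entry a c b d.
Proof. by rewrite dRE /dR_entry mulr1 !mul1r. Qed.

(** Each of the four terms of the bracket contracts [rmat] with a product of two entries of [a],
    along a row of [rmat] for the first two and along a column for the last two. Each contraction
    gives a diagonal term, an exchange term and a sum over m. *)
Lemma classical_bracketE (a : 'M[B]_N) (i j k l : 'I_N) :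
    (forall u v s t, a u v * a s t = a s t * a u v) ->
  let p := @rev_ord N in
  bracket_mx rmat 1%:M a (ti i k) (ti j l) =
    ((i == k)%:R - (i == p k)%:R + (j == k)%:R - (j == p k)%:R
     - (i == l)%:R + (i == p l)%:R - (j == l)%:R + (j == p l)%:R)
      * (a i j * a k l)
    - 2 * ((l < j)%N%:R - (i < k)%N%:R) * (a k j * a i l)
    - 2 * (l < i)%N%:R * (a k i * a l j)
    + 2 * (j < k)%N%:R * (a i k * a j l)
    + 2 * (l == p j)%:R *
        (\sum_(m < N | (m < j)%N) eps m * eps j * (a k (p m) * a i m))
    + 2 * (l == p i)%:R *
        (\sum_(m < N | (p i < m)%N)
           eps i * eps (p m) * (a k m * a (p m) j))
    - 2 * (j == p k)%:R *
        (\sum_(m < N | (p k < m)%N)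
           eps m * eps (p k) * (a i m * a (p m) l))
    - 2 * (i == p k)%:R *
        (\sum_(m < N | (i < m)%N)
           eps i * eps m * (a m j * a (p m) l)).
Proof.
move=> aC p.
have E1 : (rmat *m a _1 *m a _2) (ti i k) (ti j l) =
    \sum_x \sum_y rmat_entry i k x y * (a x j * a y l).
  rewrite -mulmxA mulmx_tensE; apply: eq_bigr => x _; apply: eq_bigr => y _.
  by rewrite rmatE mul_in1_in2E.
have E2 : (a _1 *m ptrmx rmat *m a _2) (ti i k) (ti j l) =
    \sum_x \sum_y rmat_entry j k x y * (a i x * a y l).
  rewrite -mulmxA mul_in1mxE; apply: eq_bigr => x _.
  rewrite mulmx_in2E mulr_sumr; apply: eq_bigr => y _.
  by rewrite ptrmxE rmatE mulrA -rmat_entryC mulrA.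
have E3 : (a _2 *m ptrmx rmat *m a _1) (ti i k) (ti j l) =
    \sum_x \sum_y rmat_entry x y i l * (a k y * a x j).
  rewrite -mulmxA mul_in2mxE exchange_big; apply: eq_bigr => y _.
  rewrite mulmx_in1E mulr_sumr; apply: eq_bigr => x _.
  by rewrite ptrmxE rmatE mulrA -rmat_entryC mulrA.
have E4 : (a _2 *m a _1 *m rmat) (ti i k) (ti j l) =
    \sum_x \sum_y rmat_entry x y j l * (a k y * a i x).
  rewrite mulmx_tensE; apply: eq_bigr => x _; apply: eq_bigr => y _.
  by rewrite rmatE mul_in2_in1E rmat_entryC.
rewrite bracket_mx1 [LHS]mxDE [X in X + _]mxDE [X in X + _ + _]mxDE !mxNE.
rewrite E1 E2 E3 E4 !sum_rmat_row !sum_rmat_col {E1 E2 E3 E4}.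
(* The column contractions give the diagonal products in the opposite order. *)
rewrite [a k l * a i j]aC.
pose T1 := 2 * (i == p k)%:R * \sum_(m < N | (i < m)%N) eps i * eps m * (a m j * a (p m) l).
pose T2 := 2 * (j == p k)%:R * \sum_(m < N | (p k < m)%N) eps m * eps (p k) * (a i m * a (p m) l).
pose T3 := 2 * (l == p i)%:R * \sum_(m < N | (p i < m)%N) eps i * eps (p m) * (a k m * a (p m) j).
pose T4 := 2 * (l == p j)%:R * \sum_(m < N | (m < j)%N) eps m * eps j * (a k (p m) * a i m).
have -> : 2 * (j == rev_ord k)%:R *
   (\sum_(m < N | (j < m)%N) eps j * eps m * (a i m * a (rev_ord m) l)) = T2.
  rewrite /T2; case: (eqVneq j (p k)) => [<-|_]; last by rewrite !(mulr0, mul0r).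
  by congr (_ * _); apply: eq_bigr => m _; rewrite [eps j * _]eps_comm.
(* The substitution of m' for m turns the range m < i into i' < m. *)
have -> : 2 * (l == rev_ord i)%:R *
   (\sum_(m < N | (m < i)%N) eps m * eps i * (a k (rev_ord m) * a m j)) = T3.
  congr (_ * _); rewrite [LHS](reindex_inj rev_ord_inj).
  apply: eq_big => m; first by rewrite -ltn_rev rev_ordK.
  by move=> _; rewrite rev_ordK [eps (rev_ord m) * _]eps_comm.
rewrite -/T1 -/T2 -/T3 -/T4.
(* With sums and products abstracted, both sides consist of the same sixteen terms in different
   orders. *)
move: T1 T2 T3 T4 (a i j * a k l) (a k j * a i l) (a k i * a l j) (a i k * a j l).
move=> T1 T2 T3 T4 X Y Z W; rewrite /p; move: (2 : B) => two.
rewrite mulrBr !(mulrDl, mulNr) !(opprD, opprK) !addrA.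
by rewrite [LHS](ACl (1*2*5*6*9*10*13*14*15*3*11*7*16*12*8*4)).
Qed.

End ClassicalR.

(** * The reflection equation in U_q(sp_2n) *)

Section QuotientMorphism.
Variables (K : comNzRingType) (B : algType K) (r : B -> B -> Prop).

Fact quot_pi_is_zmod_morphism : zmod_morphism (@quot_pi K B r).
Proof.
move=> u v; rewrite quot_piD; congr (_ + _).
by rewrite -quot_oppE.
Qed.

Fact quot_pi_is_monoid_morphism : monoid_morphism (@quot_pi K B r).
Proof. by split; [exact: quot_pi1 | exact: quot_piM]. Qed.

HB.instance Definition _ :=
  GRing.isZmodMorphism.Build B (quot_alg r) (@quot_pi K B r)
    quot_pi_is_zmod_morphism.
HB.instance Definition _ :=
  GRing.isMonoidMorphism.Build B (quot_alg r) (@quot_pi K B r)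
    quot_pi_is_monoid_morphism.

Lemma eq_quot_pi u v : r u v -> quot_pi r u = quot_pi r v.
Proof. by move=> ruv; apply/quot_piE; apply: rel_ideal_gen. Qed.

(** The scalars as a central subring of the quotient; matrices over [K] are transported along this
    morphism. *)
Definition quot_scal : K -> quot_alg r := @quot_pi K B r \o in_alg B.
HB.instance Definition _ := GRing.RMorphism.on quot_scal.

Lemma quot_scalE c x : quot_scal c * x = c *: x.
Proof.
by rewrite /quot_scal /= quot_piZ -quot_scaleAl mul1r.
Qed.

Lemma quot_scal_comm c x : quot_scal c * x = x * quot_scal c.
Proof.
by rewrite quot_scalE /quot_scal /= quot_piZ -quot_scaleAr mulr1.
Qed.

End QuotientMorphism.

(** * The reflection equation for S *)

Section ReflectionS.
Variables (R : realType) (n : nat).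
Local Notation N := (2 * n)%N.
Local Notation K := (ratC R).
Local Notation U := (Uq n R).
Local Notation "X '_1'" := (X *t (1%:M : 'M_N)) (at level 2).
Local Notation "X '_2'" := ((1%:M : 'M_N) *t X) (at level 2).

Definition Uscal : K -> U := quot_scal (@Uq_rel n R).
HB.instance Definition _ := GRing.RMorphism.on Uscal.

Definition RU : 'M[U]_(N * N) := map_mx Uscal (Rmx n R).

Lemma central_map_Uscal m m' (M : 'M[K]_(m, m')) : central_mx (map_mx Uscal M).
Proof. by move=> x y z; rewrite mxE quot_scal_comm. Qed.

Local Notation S := (Smx n R).

Lemma reflection_Smx :
  RU *m S _1 *m ptrmx RU *m S _2 = S _2 *m ptrmx RU *m S _1 *m RU.
Proof.
have RUE : map_mx (quot_pi (@Uq_rel n R)) (map_mx (in_alg _) (Rmx n R)) = RU.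
  by rewrite -map_mx_comp.
have JE : map_mx Uscal (Jsp n K) = Jsp n U by exact: map_Jsp.
apply: (@reflection_equation _ _ RU (Jsp n U) (Tmx n R) (Tbmx n R)).
- exact: central_map_Uscal.
- by rewrite -JE; exact: central_map_Uscal.
- by rewrite /RU map_trmx Rmx_qR trmx_qR map_flipmx.
- have := congr1 (map_mx Uscal) (reflection_J (@qC R) n).
  by rewrite -Rmx_qR map_reflection_l map_reflection_r JE.
- by rewrite -RUE; apply: map_intertwine => i j; apply: eq_quot_pi; apply: Uq_RTT.
- by rewrite -RUE; apply: map_intertwine => i j; apply: eq_quot_pi; apply: Uq_RTbTb.
- by rewrite -RUE; apply: map_intertwine => i j; apply: eq_quot_pi; apply: Uq_RTbT.
Qed.

End ReflectionS.

(** * The semiclassical limit of the subalgebra U'_A *)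

Section FreeAlgebraEval.
Variables (K : comNzRingType) (X : choiceType).

Lemma free_alg_eval_nz (S : nzRingType) (f : {rmorphism K -> S}) (g : X -> S) :
    (forall c s, f c * s = s * f c) ->
  exists ev : {rmorphism free_alg K X -> S},
    (forall x, ev (free_gen K x) = g x) /\ (forall c u, ev (c *: u) = f c * ev u).
Proof.
move=> fC; pose h (m : {fmonom X}) := \prod_(x <- fmonom_val m) g x.
have h_mor : mmorphism h.
  by split=> [m1 m2|]; rewrite /h ?fm1 ?fmM ?big_cat ?big_nil.
pose hM := isMultiplicative.Build {fmonom X} S h h_mor.
pose hm : {mmorphism {fmonom X} -> S} := HB.pack h hM.
have evM : monoid_morphism (mmap f hm : free_alg K X -> S).
  have [evM ev1] := @commr_mmap_is_multiplicative _ _ _ f hm (fun _ _ _ => fC _ _).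
  by split.
pose evZ := GRing.isZmodMorphism.Build _ _ (mmap f hm : free_alg K X -> S)
  (@mmap_is_additive _ _ _ f hm).
pose evR := GRing.isMonoidMorphism.Build _ _ (mmap f hm : free_alg K X -> S) evM.
pose ev : {rmorphism free_alg K X -> S} :=
  HB.pack (mmap f hm : free_alg K X -> S) evZ evR.
exists ev; split=> [x|c u] /=.
  have f1 : f 1 = 1 := rmorph1 f.
  by rewrite mmapU [X in X * _]f1 mul1r /= /h fmU big_seq1.
exact: (@mmapZ _ _ _ f hm c u).
Qed.

(** The universal property of the free algebra. It is needed for targets not known to be nonzero,
    such as U'_A, so the zero ring is treated separately. *)
Lemma free_alg_eval (S : pzRingType) (f : {rmorphism K -> S}) (g : X -> S) :
    (forall c s, f c * s = s * f c) ->
  exists ev : {rmorphism free_alg K X -> S},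
    (forall x, ev (free_gen K x) = g x) /\ (forall c u, ev (c *: u) = f c * ev u).
Proof.
move=> fC; have [S0|S1] := eqVneq (1 : S) 0.
  have S_0 (s : S) : s = 0 by rewrite -[s]mul1r S0 mul0r.
  pose z (_ : free_alg K X) := 0 : S.
  pose zZ := GRing.isZmodMorphism.Build _ _ z (fun _ _ => esym (subrr _)).
  have zM : monoid_morphism z by split=> // *; exact: S_0.
  pose zR := GRing.isMonoidMorphism.Build _ _ z zM.
  pose ev : {rmorphism free_alg K X -> S} := HB.pack z zZ zR.
  by exists ev; split=> *; rewrite [LHS]S_0 [RHS]S_0.
pose SM := GRing.PzSemiRing_isNonZero.Build S S1.
pose S' : nzRingType := HB.pack (GRing.PzRing.sort S) (GRing.PzRing.class S) SM.
exact: (@free_alg_eval_nz S' f g).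
Qed.

End FreeAlgebraEval.

(** * The kernel of the specialisation from U'_A to P_n *)

Section PoissonAlgebra.
Variables (R : realType) (n : nat).
Local Notation L := (laurent R).
Local Notation C := (complex R).
Local Notation U := (Uq n R).
Local Notation UA := (UA n R).
Local Notation P := (Pn n R).
Local Notation toP := (@to_Pn n R).

Lemma val_UAZ (a : L) (u : UA) : val (a *: u) = val a *: val u :> U.
Proof. by []. Qed.

Lemma UA_scalerAl (a : L) (u v : UA) : a *: (u * v) = a *: u * v.
Proof. by apply: val_inj; rewrite /= quot_scaleAl. Qed.

Lemma UA_scalerAr (a : L) (u v : UA) : a *: (u * v) = u * (a *: v).
Proof. by apply: val_inj; rewrite /= quot_scaleAr. Qed.

Fact to_Pn_is_zmod_morphism : zmod_morphism toP.
Proof.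
have toPD : {morph toP : u v / u + v}.
  by move=> u v; rewrite -quot_piD; apply: eq_quot_pi; apply: tensor_Dl.
by move=> u v; apply/eqP; rewrite eq_sym subr_eq -toPD subrK.
Qed.

Fact to_Pn_is_monoid_morphism : monoid_morphism toP.
Proof.
split=> [|u v]; first by apply: eq_quot_pi; apply: tensor_1.
rewrite -quot_piM; apply/esym/eq_quot_pi.
by have := tensor_M u v (1 : C) 1; rewrite mulr1.
Qed.

HB.instance Definition _ :=
  GRing.isZmodMorphism.Build UA P toP to_Pn_is_zmod_morphism.
HB.instance Definition _ :=
  GRing.isMonoidMorphism.Build UA P toP to_Pn_is_monoid_morphism.

Lemma to_PnZ (a : L) (u : UA) : toP (a *: u) = eval1 a *: toP u.
Proof.
rewrite -quot_piZ; transitivity (quot_pi (@tensor_rel n R)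
    (free_gen C (X := (UA * C)%type) (u, eval1 a * 1))).
  by apply: eq_quot_pi; apply: tensor_balanced.
by apply/esym/eq_quot_pi; apply: tensor_scale.
Qed.

Definition UAscal (a : L) : UA := a *: (1 : UA).

Fact UAscal_is_zmod_morphism : zmod_morphism UAscal.
Proof. by move=> a b; rewrite /UAscal scalerBl. Qed.

Fact UAscal_is_monoid_morphism : monoid_morphism UAscal.
Proof.
split=> [|a b]; first by rewrite /UAscal scale1r.
by rewrite /UAscal -UA_scalerAl mul1r scalerA.
Qed.

HB.instance Definition _ :=
  GRing.isZmodMorphism.Build L UA UAscal UAscal_is_zmod_morphism.
HB.instance Definition _ :=
  GRing.isMonoidMorphism.Build L UA UAscal UAscal_is_monoid_morphism.

Lemma UAscalE a u : UAscal a * u = a *: u.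
Proof. by rewrite /UAscal -UA_scalerAl mul1r. Qed.

Lemma UAscalC a u : UAscal a * u = u * UAscal a.
Proof. by rewrite UAscalE /UAscal -UA_scalerAr mulr1. Qed.

Fact lconst_subproof (c : C) : @FracField.tofrac _ c%:P \in @laurent_pred R.
Proof. by apply/asboolP; exists c%:P, 0%N; rewrite expr0 divr1. Qed.
(** A section of evaluation at q = 1; it gives a symbol u (x) c a value in U'_A. *)
Definition lconst (c : C) : L := Sub (FracField.tofrac c%:P) (lconst_subproof c).

Fact lconst_is_zmod_morphism : zmod_morphism lconst.
Proof. by move=> a b; apply: val_inj; rewrite /= polyCB tofracB. Qed.

Fact lconst_is_monoid_morphism : monoid_morphism lconst.
Proof.
by split=> [|a b]; apply: val_inj; rewrite /= ?tofrac1 // polyCM tofracM.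
Qed.

HB.instance Definition _ :=
  GRing.isZmodMorphism.Build C L lconst lconst_is_zmod_morphism.
HB.instance Definition _ :=
  GRing.isMonoidMorphism.Build C L lconst lconst_is_monoid_morphism.

Lemma lconstK c : eval1 (lconst c) = c.
Proof. by rewrite (@eval1E _ _ c%:P 0) ?hornerC // expr0 divr1. Qed.

Fact lq_subproof (z : int) : (qC ^ z : ratC R) \in @laurent_pred R.
Proof.
apply/asboolP; case: z => [k|k].
  by exists 'X^k, 0%N; rewrite expr0 divr1 tofracXn.
by exists 1, k.+1; rewrite tofrac1 mul1r.
Qed.
Definition lq (z : int) : L := Sub (qC ^ z) (lq_subproof z).

Lemma eval1_lq z : eval1 (lq z) = 1.
Proof.
case: z => k.
  by rewrite (@eval1E _ _ 'X^k 0) ?hornerXn ?expr1n //= expr0 divr1 tofracXn.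
by rewrite (@eval1E _ _ 1 k.+1) ?hornerC //= tofrac1 mul1r.
Qed.

(** The numerator vanishes at 1, so it is divisible by X - 1. *)
Lemma eval1_eq0 (a : L) : eval1 a = 0 -> exists b, a = (1 - lq 1) * b.
Proof.
have [[p k] /= aE] := laurentP a; rewrite (eval1E aE) => /eqP p1.
have /factor_theorem[p' pE] : root p 1 by [].
(* The sign comes from writing the factor q - 1 as -(1 - q). *)
have p'L : @FracField.tofrac _ (- p') / qC ^+ k \in @laurent_pred R.
  by apply/asboolP; exists (- p'), k.
exists (Sub (FracField.tofrac (- p') / qC ^+ k) p'L : L); apply: val_inj.
rewrite rmorphM rmorphB rmorph1 /= aE pE.
rewrite tofracM tofracB tofracN expr1z polyC1 tofrac1 -/qC; ring.
Qed.

(** The free algebra on the symbols u (x) c maps to U'_A by sending u (x) c to c u. This sends every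
    relation of the tensor product into the two-sided ideal (1 - q) U'_A, hence also the ideal that
    the relations generate. *)
Lemma to_Pn_eq (u v : UA) : toP u = toP v -> exists w, u - v = (1 - lq 1) *: w.
Proof.
pose inI (w : UA) := exists w', w = (1 - lq 1) *: w'.
have I0 : inI 0 by exists 0; rewrite scaler0.
have ID w w' : inI w -> inI w' -> inI (w + w').
  by move=> [x ->] [y ->]; exists (x + y); rewrite scalerDr.
have IMl w w' : inI w' -> inI (w * w').
  by move=> [y ->]; exists (w * y); rewrite UA_scalerAr.
have IMr w w' : inI w -> inI (w * w').
  by move=> [y ->]; exists (y * w'); rewrite UA_scalerAl.
have [f fE] : exists f : {rmorphism C -> UA}, forall c, f c = UAscal (lconst c).
  by exists (UAscal \o lconst).
have fC c s : f c * s = s * f c by rewrite fE UAscalC.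
have [ev [evg' evZ]] := free_alg_eval (fun uc : UA * C => f uc.2 * uc.1) fC.
have evg u' c : ev (free_gen C (u', c)) = f c * u' by exact: evg'.
have evM x y : ev (x * y) = ev x * ev y by exact: rmorphM.
have evD x y : ev (x + y) = ev x + ev y by exact: rmorphD.
have evB x y : ev (x - y) = ev x - ev y by exact: rmorphB.
have ev0 : ev 0 = 0 by exact: rmorph0.
have ev1 : ev 1 = 1 by exact: rmorph1.
have relI x y : @tensor_rel n R x y -> inI (ev x - ev y).
  case=> [u' v' c|u' c d|a u' c|d u' c|u' v' c d|].
  - by rewrite evD !evg mulrDr subrr.
  - by rewrite evD !evg rmorphD mulrDl subrr.
  (* The balancing relation holds only modulo 1 - q: a Laurent polynomial differs from its value at
     1 by a multiple of 1 - q. The other relations hold exactly in U'_A. *)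
  - have [b bE] : exists b, a - lconst (eval1 a) = (1 - lq 1) * b.
      by apply: eval1_eq0; rewrite rmorphB /= lconstK subrr.
    exists (b *: (f c * u')); rewrite !evg rmorphM scalerA -bE scalerBl.
    by rewrite UA_scalerAr -mulrA [in f (eval1 a)]fE UAscalE.
  - by rewrite evZ !evg mulrA -rmorphM subrr.
  - rewrite evM !evg rmorphM -!mulrA [u' * (f d * _)]mulrA.
    by rewrite -fC -mulrA subrr.
  - by rewrite ev1 evg rmorph1 mulr1 subrr.
have evI x : rel_ideal (@tensor_rel n R) x -> inI (ev x).
  elim=> [x' y' /relI||x' y' _ + _|x' w _ IH|x' w _ IH].
  - by rewrite evB.
  - by rewrite ev0.
  - by rewrite evD; apply: ID.
  - by rewrite evM; apply: IMl.
  - by rewrite evM; apply: IMr.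
by rewrite /to_Pn => /quot_piE/evI; rewrite evB !evg rmorph1 !mul1r.
Qed.

End PoissonAlgebra.

Lemma commutatorB (A : pzRingType) (u v u' v' : A) :
  (u * v - v * u) - (u' * v' - v' * u') =
  ((u - u') * v - v * (u - u')) + (u' * (v - v') - (v - v') * u').
Proof.
rewrite !(mulrBl, mulrBr) !(opprB, opprD, opprK) !addrA.
by rewrite [RHS](ACl (1*4*7*6*(2*5)*(3*8))) /= addNr subrr !addr0.
Qed.

(** * Divisibility of commutators by 1 - q, and uniqueness of the bracket *)

Section LaurentR.
Variables (R : realType) (n : nat).
Local Notation N := (2 * n)%N.
Local Notation K := (ratC R).
Local Notation L := (laurent R).
Local Notation q := (@qC R).
Local Notation UA := (UA n R).
Local Notation U := (Uq n R).
Local Notation P := (Pn n R).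
Local Notation toP := (@to_Pn n R).
Local Notation lq := (@lq R).
Local Notation h := (1 - lq 1).
Local Notation "X '_1'" := (X *t (1%:M : 'M_N)) (at level 2).
Local Notation "X '_2'" := ((1%:M : 'M_N) *t X) (at level 2).

(** The R-matrix over C[q, q^-1], defined by its decomposition so that R - 1 is visibly divisible by
    1 - q over this ring. *)
Definition Rlaurent : 'M[L]_(N * N) := 1%:M - h *: dR n lq.

Lemma val_Rlaurent : map_mx val Rlaurent = Rmx n R.
Proof.
pose f : {rmorphism L -> K} := val.
have fh : f h = 1 - q by rewrite -[q]expr1z; exact: rmorphB.
rewrite Rmx_qR (qR_dR n (@qC_neq0 R)) -[LHS]/(map_mx f _).
by rewrite map_mxB map_mx1 map_mxZ map_dR [X in X *: _]fh.
Qed.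

Definition RUA : 'M[UA]_(N * N) := map_mx (@UAscal R n) Rlaurent.

Lemma val_RUA : map_mx val RUA = RU R n.
Proof.
rewrite /RUA /RU -val_Rlaurent -!map_mx_comp; apply: eq_map_mx => x /=.
by rewrite /Uscal /quot_scal /= quot_piZ.
Qed.

(** The lift of S to U'_A. Its diagonal and upper entries are written out because only the s_ij with
    i > j are generators; triangularity of T and Tb shows that they are the entries of S. *)
Definition SUA : 'M[UA]_N := \matrix_(i, j)
  (if (j < i)%N then sUA R i j else if i == j then eps UA i else 0).

Lemma val_SUA : map_mx val SUA = Smx n R.
Proof.
have pi0 u : Uq_rel u 0 -> quot_pi (@Uq_rel n R) u = 0 by exact: eq_quot_pi.
apply/matrixP => i j; rewrite mxE [SUA i j]mxE.
case: (ltnP j i) => [ji|ij]; first exact: val_sUA.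
have -> : Smx n R i j = if i == j then eps U i else 0.
  apply: triangular_mul_Jsp ij => [a b ab|a b ab|a].
  - by rewrite mxE; apply: pi0; apply: Uq_tri.
  - by rewrite mxE; apply: pi0; apply: Uq_trib.
  - rewrite [Tmx n R a a]mxE [Tbmx n R a a]mxE -quot_piM.
    exact: (eq_quot_pi (Uq_diag _ _)).
case: eqP => _; first exact: (@rmorph_eps _ UA U val).
exact: rmorph0.
Qed.

Lemma a_genE i j : a_gen R i j = toP (SUA i j).
Proof.
rewrite mxE /a_gen; case: ifP => // _; case: ifP => _; last by rewrite rmorph0.
by rewrite rmorph_eps.
Qed.

Lemma reflection_SUA :
  RUA *m SUA _1 *m ptrmx RUA *m SUA _2 =
  SUA _2 *m ptrmx RUA *m SUA _1 *m RUA.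
Proof.
pose f : {rmorphism UA -> U} := val.
have fR : map_mx f RUA = RU R n := val_RUA.
have fS : map_mx f SUA = Smx n R := val_SUA.
have E : map_mx f (RUA *m SUA _1 *m ptrmx RUA *m SUA _2) =
         map_mx f (SUA _2 *m ptrmx RUA *m SUA _1 *m RUA).
  by rewrite (map_reflection_l f) (map_reflection_r f) fR fS; exact: reflection_Smx.
apply/matrixP => x y; apply: val_inj.
by have := congr1 (fun M : 'M__ => M x y) E; rewrite [LHS]mxE [RHS]mxE.
Qed.

Definition rUA : 'M[UA]_(N * N) := map_mx (@UAscal R n) (dR n lq).

Lemma RUA_decomp : RUA = 1%:M - UAscal n h *: rUA.
Proof. by rewrite /RUA /Rlaurent map_mxB map_mx1 map_mxZ. Qed.

(** The commutators of the s_ij divided by 1 - q; being a matrix over [UA], it certifies that these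
    quotients lie in U'_A. *)
Definition comm_quotient : 'M[UA]_(N * N) := bracket_mx rUA RUA SUA.

Lemma commutator_SUA (i j k l : 'I_N) :
  SUA i j * SUA k l - SUA k l * SUA i j = h *: comm_quotient (ti i k) (ti j l).
Proof.
rewrite (bracket_mxE i j k l (@UAscalC R n h) RUA_decomp reflection_SUA).
exact: UAscalE.
Qed.

Lemma to_PnD (u v : UA) : toP (u + v) = toP u + toP v.
Proof. exact: (rmorphD toP). Qed.

Lemma to_PnB (u v : UA) : toP (u - v) = toP u - toP v.
Proof. exact: (rmorphB toP). Qed.

Lemma to_PnM (u v : UA) : toP (u * v) = toP u * toP v.
Proof. exact: (rmorphM toP). Qed.

Lemma toP_h0 (w : UA) : toP (h *: w) = 0.
Proof. by rewrite to_PnZ rmorphB rmorph1 /= eval1_lq subrr scale0r. Qed.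

Lemma to_Pn_UAscal_lq z : toP (UAscal n (lq z)) = 1.
Proof. by rewrite /UAscal to_PnZ eval1_lq scale1r rmorph1. Qed.

Lemma map_to_Pn_rUA : map_mx toP rUA = rmat P n.
Proof.
rewrite -map_mx_comp -[LHS]/(map_mx (toP \o @UAscal R n) _) map_dR.
by congr (dR n _); apply/funext => z; exact: to_Pn_UAscal_lq.
Qed.

Lemma map_to_Pn_RUA : map_mx toP RUA = 1%:M.
Proof.
rewrite RUA_decomp map_mxB map_mxZ map_mx1.
have h0 : toP (UAscal n h) = 0 by exact: toP_h0.
by rewrite [X in X *: _]h0 scale0r subr0.
Qed.

Lemma to_Pn_SUA_comm (u v s t : 'I_N) :
  toP (SUA u v) * toP (SUA s t) = toP (SUA s t) * toP (SUA u v).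
Proof.
by apply: subr0_eq; rewrite -!to_PnM -to_PnB commutator_SUA; exact: toP_h0.
Qed.

Lemma map_to_Pn_comm_quotient :
  map_mx toP comm_quotient = bracket_mx (rmat P n) 1%:M (map_mx toP SUA).
Proof. by rewrite map_bracket_mx map_to_Pn_RUA map_to_Pn_rUA. Qed.

Lemma UA_ind (Q : UA -> Prop) :
    (forall i j : 'I_N, (j < i)%N -> Q (SUA i j)) -> Q 1 ->
    (forall u v, Q u -> Q v -> Q (u + v)) ->
    (forall u v, Q u -> Q v -> Q (u * v)) ->
    (forall a u, Q u -> Q (a *: u)) ->
  forall u, Q u.
Proof.
move=> QS Q1 QD QM QZ u; have /asboolP := valP u.
(* The induction runs over elements of U_q(sp_2n), so the claim is made for every lift to U'_A. *)
suff H x : UA_span x -> forall v : UA, val v = x -> Q v by move/H; apply.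
have mem y : UA_span y -> y \in @UA_pred n R by move=> yU; apply/asboolP.
elim=> {x} [i j ji||||].
- move=> v vE; have -> : v = SUA i j; last exact: QS.
  by apply: val_inj; rewrite vE -val_SUA mxE.
- by move=> v vE; have -> : v = 1 by exact: val_inj.
- move=> x y /mem xU IHx /mem yU IHy v vE.
  have -> : v = Sub x xU + Sub y yU :> UA by apply: val_inj; rewrite vE.
  by apply: QD; [apply: IHx|apply: IHy].
- move=> x y /mem xU IHx /mem yU IHy v vE.
  have -> : v = Sub x xU * Sub y yU :> UA by apply: val_inj; rewrite vE.
  by apply: QM; [apply: IHx|apply: IHy].
- move=> a x /mem xU IHx v vE.
  have -> : v = a *: (Sub x xU : UA) by apply: val_inj; rewrite vE.
  by apply: QZ; apply: IHx.
Qed.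

(** The images of the generators commute because their commutators are multiples of 1 - q. Induction
    on one argument and, by symmetry, on the other extends this to the image of U'_A. *)
Lemma to_Pn_comm (u v : UA) : GRing.comm (toP u) (toP v).
Proof.
have step (x : P) :
    (forall i j : 'I_N, (j < i)%N -> GRing.comm x (toP (SUA i j))) ->
    forall w, GRing.comm x (toP w).
  move=> xS; apply: (@UA_ind (fun w => GRing.comm x (toP w))).
  - exact: xS.
  - by rewrite rmorph1; exact: commr1.
  - by move=> w w' xw xw'; rewrite to_PnD; exact: commrD.
  - by move=> w w' xw xw'; rewrite to_PnM; exact: commrM.
  - move=> a w xw; rewrite to_PnZ /GRing.comm.
    by rewrite -quot_scaleAl -quot_scaleAr xw.
apply: (step) => i j _; apply/commr_sym; apply: (step) => k l _.
exact: to_Pn_SUA_comm.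
Qed.

Lemma to_Pn_commutator (u v : UA) : toP (u * v - v * u) = 0.
Proof. by rewrite to_PnB !to_PnM (to_Pn_comm u v : _ = _); exact: subrr. Qed.

Lemma subr1_qC_neq0 : 1 - q != 0.
Proof.
rewrite subr_eq0 -(tofrac1 {poly (complex R)}) tofrac_eq.
by apply/eqP => /(congr1 (fun p : {poly _} => p`_0)) /eqP; rewrite coefX coef1 oner_eq0.
Qed.

Lemma val_h : val h = 1 - q.
Proof. by rewrite -[q]expr1z; exact: rmorphB. Qed.

Lemma val_bracketE (u v w : UA) :
  val w = (1 - q)^-1 *: (val u * val v - val v * val u) <->
  u * v - v * u = h *: w.
Proof.
have -> : val u * val v - val v * val u = val (u * v - v * u) by [].
split=> [wE|->].
  by apply: val_inj; rewrite val_UAZ wE scalerA val_h (mulfV subr1_qC_neq0) scale1r.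
by rewrite val_UAZ scalerA val_h (mulVf subr1_qC_neq0) scale1r.
Qed.

(** U'_A has no (1 - q)-torsion, since it lies in a vector space over C(q). *)
Lemma UAscaler_inj (u v : UA) : h *: u = h *: v -> u = v.
Proof.
move/(congr1 val); rewrite !val_UAZ val_h.
by move/(scalerI subr1_qC_neq0)/val_inj.
Qed.

(** Two lifts of the same element differ by a multiple of 1 - q. Dividing the difference of the two
    commutators by 1 - q therefore leaves a sum of commutators in U'_A, and these vanish in P_n. *)
Lemma Pn_bracket_spec_uniq (x y z z' : P) :
  Pn_bracket_spec x y z -> Pn_bracket_spec x y z' -> z = z'.
Proof.
move=> [u [v [w [-> -> -> wE]]]] [u' [v' [w' [uE vE -> wE']]]].
have [du duE] := to_Pn_eq uE; have [dv dvE] := to_Pn_eq vE.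
move/val_bracketE in wE; move/val_bracketE in wE'.
have wwE : w - w' = (du * v - v * du) + (u' * dv - dv * u').
  apply: UAscaler_inj; rewrite scalerBr -wE -wE' commutatorB duE dvE.
  by rewrite scalerDr !scalerBr -!UA_scalerAl -!UA_scalerAr.
apply: subr0_eq; rewrite -to_PnB wwE to_PnD.
by rewrite (to_Pn_commutator du v) (to_Pn_commutator u' dv) addr0.
Qed.

End LaurentR.

(** * The formula for the Poisson bracket *)

Theorem theorem6p1 (R : realType) (n : nat) (n_ge1 : (1 <= n)%N)
    (i j k l : 'I_(2 * n)) (ji : (j < i)%N) (lk : (l < k)%N) :
  let P := Pn n R in
  let a := @a_gen n R in
  let eps := @eps n P in
  let p := @rev_ord (2 * n) in
  Pn_bracket (a i j) (a k l) =
    ((i == k)%:R - (i == p k)%:R + (j == k)%:R - (j == p k)%:R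
     - (i == l)%:R + (i == p l)%:R - (j == l)%:R + (j == p l)%:R)
      * (a i j * a k l)
    - 2 * ((l < j)%N%:R - (i < k)%N%:R) * (a k j * a i l)
    - 2 * (l < i)%N%:R * (a k i * a l j)
    + 2 * (j < k)%N%:R * (a i k * a j l)
    + 2 * (l == p j)%:R *
        (\sum_(m < 2 * n | (m < j)%N) eps m * eps j * (a k (p m) * a i m))
    + 2 * (l == p i)%:R *
        (\sum_(m < 2 * n | (p i < m)%N)
           eps i * eps (p m) * (a k m * a (p m) j))
    - 2 * (j == p k)%:R *
        (\sum_(m < 2 * n | (p k < m)%N)
           eps m * eps (p k) * (a i m * a (p m) l))
    - 2 * (i == p k)%:R *
        (\sum_(m < 2 * n | (i < m)%N)
           eps i * eps m * (a m j * a (p m) l)).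
Proof.
move=> P a eps p.
pose w := comm_quotient R n (mxtens_index (i, k)) (mxtens_index (j, l)).
have spec : Pn_bracket_spec (a i j) (a k l) (to_Pn w).
  exists (SUA R n i j), (SUA R n k l), w; split => //; rewrite /a ?a_genE //.
  exact/val_bracketE/commutator_SUA.
(* The witness [w] rules out the default value 0 of [xget], and uniqueness identifies the chosen
   class with that of [w]. *)
have -> : Pn_bracket (a i j) (a k l) = to_Pn w.
  exact: (Pn_bracket_spec_uniq (xgetI _ spec) spec).
pose A : 'M[P]_(2 * n) := map_mx (@to_Pn n R) (SUA R n).
(* The elements a_ij are the entries of the image of S in P_n, including a_ii = eps_i and a_ij = 0
   for i < j. *)
have aE : a = fun_of_matrix A.
  by apply/funext => u; apply/funext => v; rewrite /a a_genE [RHS]mxE.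
have -> : to_Pn w = map_mx (@to_Pn n R) (comm_quotient R n)
                      (mxtens_index (i, k)) (mxtens_index (j, l)).
  by rewrite mxE.
rewrite map_to_Pn_comm_quotient -/A aE; apply: classical_bracketE.
by move=> u v s t; rewrite -aE /a !a_genE; exact: to_Pn_SUA_comm.
Qed.
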